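(* Let $D$ be a bounded convex open subset of $\mathbb R^N$ containing the origin. Every horofunction of the Hilbert geometry on $D$ is a Busemann point if and only if the set of extreme sets of the polar $D^\circ$ of $D$ is closed in the Painlevé–Kuratowski topology.
   Context: Hilbert distance on $D$: for distinct $x,y\in D$, let $w,z\in\partial D$ be such that $w,x,y,z$ are collinear in this order; then $d_H(x,y):=\log\frac{|zx|\,|wy|}{|zy|\,|wx|}$, and $d_H(x,x)=0$. Fix a basepoint $b\in D$. A sequence $(x_n)$ in $D$ converges to $g:D\to\mathbb R$ if $d_H(\cdot,x_n)-d_H(b,x_n)\to g$ pointwise; a horofunction is such a limit not of the form $d_H(\cdot,p)-d_H(b,p)$, $p\in D$. An almost-geodesic is a sequence $(x_l)_{l\in\mathbb N}$ in $D$ such that for some $\epsilon>0$, $\sum_{i=1}^l d_H(x_{i-1},x_i)\le d_H(x_0,x_l)+\epsilon$ for all $l\ge 1$; a Busemann point is a horofunction that is the limit of an almost-geodesic. The polar is $D^\circ=\{y\in\mathbb R^N:\langle y,x\rangle\le1\ \forall x\in D\}$. A convex subset $E$ of a convex set $K$ is an extreme set if whenever a relative interior point of a line segment in $K$ lies in $E$, both endpoints lie in $E$. Painlevé–Kuratowski convergence of closed sets: $C_n\to C$ iff (i) every $x\in C$ is the limit of some $x_n\in C_n$ ($n$ large), and (ii) whenever $x_k\in C_{n_k}$ for a subsequence and $x_k\to x$, then $x\in C$. A family of closed sets is closed if it contains all Painlevé–Kuratowski limits of sequences from it. *)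

(* Defs.v *)
From HB Require Import structures.
From mathcomp Require Import all_boot all_order all_algebra.
From mathcomp Require Import all_classical all_reals all_analysis.
Set Implicit Arguments. Unset Strict Implicit. Unset Printing Implicit Defensive.
Import Order.TTheory GRing.Theory Num.Theory.
Import numFieldNormedType.Exports.
Local Open Scope classical_set_scope.
Local Open Scope ring_scope.

Section HilbertDefs.
Variables (R : realType) (N : nat).
Local Notation V := 'rV[R]_N.

Definition dotp (u v : V) : R := \sum_(i < N) u ord0 i * v ord0 i.

Definition convex (K : set V) : Prop :=
  forall x y (t : R), K x -> K y -> 0 <= t -> t <= 1 -> K ((1 - t) *: x + t *: y).

(* boundary points of D on the line through x and y:
   z = the boundary point beyond y (on the ray from x through y),
   w = the boundary point beyond x (on the ray from y through x).
   For D bounded, convex, open these are exactly the two points of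
   the line in the boundary of D, with w, x, y, z in this order. *)
Definition hilbert_z (D : set V) (x y : V) : V :=
  x + sup [set t : R | 0 <= t /\ D (x + t *: (y - x))] *: (y - x).
Definition hilbert_w (D : set V) (x y : V) : V :=
  x - sup [set t : R | 0 <= t /\ D (x - t *: (y - x))] *: (y - x).

(* Hilbert distance d_H(x,y) = log (|zx| |wy|) / (|zy| |wx|), d_H(x,x) = 0.
   (Ratios of lengths of collinear segments do not depend on the norm.) *)
Definition hilbert_dist (D : set V) (x y : V) : R :=
  if x == y then 0 else
  let z := hilbert_z D x y in
  let w := hilbert_w D x y in
  ln ((`|z - x| * `|w - y|) / (`|z - y| * `|w - x|)).

Definition seq_converges_to (D : set V) (b : V) (x : nat -> V) (g : V -> R) : Prop :=
  forall y, D y ->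
    (fun n => hilbert_dist D y (x n) - hilbert_dist D b (x n)) @ \oo --> g y.

Definition horofunction (D : set V) (b : V) (g : V -> R) : Prop :=
  (exists x : nat -> V, (forall n, D (x n)) /\ seq_converges_to D b x g) /\
  ~ (exists p, D p /\ forall y, D y -> g y = hilbert_dist D y p - hilbert_dist D b p).

Definition almost_geodesic (D : set V) (x : nat -> V) : Prop :=
  (forall n, D (x n)) /\
  exists eps : R, 0 < eps /\
    forall l : nat, (1 <= l)%N ->
      \sum_(1 <= i < l.+1) hilbert_dist D (x i.-1) (x i)
        <= hilbert_dist D (x 0%N) (x l) + eps.

Definition busemann_point (D : set V) (b : V) (g : V -> R) : Prop :=
  horofunction D b g /\
  exists x : nat -> V, almost_geodesic D x /\ seq_converges_to D b x g.

Definition polar (D : set V) : set V :=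
  [set y | forall x, D x -> dotp y x <= 1].

Definition extreme_set (K E : set V) : Prop :=
  E `<=` K /\ convex E /\
  forall p q (t : R), K p -> K q -> 0 < t -> t < 1 ->
    E ((1 - t) *: p + t *: q) -> E p /\ E q.

Definition PK_converges (C_ : nat -> set V) (C : set V) : Prop :=
  (forall x, C x -> exists x_ : nat -> V,
      (\forall n \near \oo, C_ n (x_ n)) /\ x_ @ \oo --> x) /\
  (forall (nk : nat -> nat) (x_ : nat -> V) (x : V),
      (forall k, (nk k < nk k.+1)%N) ->
      (forall k, C_ (nk k) (x_ k)) -> x_ @ \oo --> x -> C x).

Definition PK_closed_family (F : set V -> Prop) : Prop :=
  forall (C_ : nat -> set V) (C : set V),
    (forall n, closed (C_ n)) -> (forall n, F (C_ n)) -> closed C ->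
    PK_converges C_ C -> F C.

End HilbertDefs.

(* Main.v *)
(* Put [K := polar D] and [ell x u := 1 - <u, x>], a function of [u]; up to scale, the points of [D]
   are the affine functions positive on [K].  With [M(y, x) := max_K ell y / ell x] the Hilbert
   distance is [ln M(y, x) + ln M(x, y)], a Funk part plus a reverse Funk part.  If [x_n] tends to a
   horofunction [g] and to [p] in the closure of [D], the reverse part converges to a function of [p]
   alone, while the Funk part is governed by the epi-limit [a : K -> [0, +oo]] of the functions
   [a_n := M(b, x_n) ell x_n].

   If the extreme sets of [K] form a closed family, then [K] is stable: the maps
   [(u, v) |-> (1 - t) u + t v] are open on [K].  This is proved by induction on the dimension of the
   face containing the point to be decomposed.  Stability makes [a] affine, hence by separation the
   affine minorants [c ell z], [z] in [D], of [a] are directed upwards.  Moving along such a cofinal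
   sequence towards [p] gives points [z_n -> g] with [d(b, z_n) + g(z_n) -> 0], and such a sequence
   contains an almost-geodesic.

   Conversely, an almost-geodesic [z_n -> g] satisfies [d(b, z_n) + g(z_n) -> 0], which forces
   [M(b, z_n) ell z_n <= (1 + o(1)) a]; a separation argument then shows that the domain of [a] is an
   extreme set.  If extreme sets [E_n] converge to a set that is not extreme, points [w_n] in [E_n]
   tend to [m] in the open segment [(u, q)] while the [E_n] stay away from [q]; separation yields
   affine functions [c_n ell x_n] bounded at [w_n] and tending to infinity near [q], so [m] but not
   [q] lies in the domain of [a], for a limit [g] of a subsequence of [x_n].  Limits are taken along
   an ultrafilter, and subsequences are extracted afterwards. *)
Require Import Defs.
From HB Require Import structures.
From mathcomp Require Import all_boot all_order all_algebra.
From mathcomp Require Import all_classical all_reals all_analysis.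
From mathcomp Require Import ring lra.
Import Order.TTheory GRing.Theory Num.Theory.
Import numFieldNormedType.Exports.
Local Open Scope classical_set_scope.
Local Open Scope ring_scope.
Set Implicit Arguments.
Unset Strict Implicit.
Unset Printing Implicit Defensive.

(** * Inner product and separation *)

Section DotProduct.
Variables (R : realType) (N : nat).
Local Notation V := 'rV[R]_N.
Implicit Types (x y z u v w : V) (A K : set V).

Lemma dotpC u v : dotp u v = dotp v u.
Proof. by apply: eq_bigr => i _; rewrite mulrC. Qed.

Lemma dotpDl u v w : dotp (u + v) w = dotp u w + dotp v w.
Proof. by rewrite -big_split; apply: eq_bigr => i _; rewrite mxE mulrDl. Qed.

Lemma dotpZl a u w : dotp (a *: u) w = a * dotp u w.
Proof. by rewrite mulr_sumr; apply: eq_bigr => i _; rewrite mxE mulrA. Qed.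

Lemma dotpDr u v w : dotp w (u + v) = dotp w u + dotp w v.
Proof. by rewrite dotpC dotpDl !(dotpC w). Qed.

Lemma dotpZr a u w : dotp w (a *: u) = a * dotp w u.
Proof. by rewrite dotpC dotpZl (dotpC w). Qed.

Lemma dotpNl u w : dotp (- u) w = - dotp u w.
Proof. by rewrite -scaleN1r dotpZl mulN1r. Qed.

Lemma dotpNr u w : dotp w (- u) = - dotp w u.
Proof. by rewrite -scaleN1r dotpZr mulN1r. Qed.

Lemma dotp0l w : dotp 0 w = 0.
Proof. by rewrite -(scale0r 0) dotpZl mul0r. Qed.

Lemma dotp0r w : dotp w 0 = 0.
Proof. by rewrite dotpC dotp0l. Qed.

Definition dotpE :=
  (dotpDl, dotpDr, dotpZl, dotpZr, dotpNl, dotpNr, dotp0l, dotp0r).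

Lemma coord_le_norm u (i : 'I_N) : `|u ord0 i| <= `|u|.
Proof.
rewrite [leRHS]/Num.norm /= mx_normrE.
by apply/bigmax_geP; right => /=; exists (ord0, i).
Qed.

(** The norm is the sup norm, so the Cauchy-Schwarz bound carries a dimensional factor; [N.+1]
    rather than [N] keeps it positive when [N = 0]. *)
Lemma norm_dotp_le u v : `|dotp u v| <= N.+1%:R * `|u| * `|v|.
Proof.
apply: (le_trans (ler_norm_sum _ _ _)).
have -> : N.+1%:R * `|u| * `|v| = `|u| * `|v| + \sum_(i < N) `|u| * `|v|.
  by rewrite sumr_const card_ord -mulrA mulr_natl mulrS.
apply: ler_wpDl; first exact: mulr_ge0.
by apply: ler_sum => i _; rewrite normrM ler_pM // coord_le_norm.
Qed.

Lemma norm_sqr_le_dotp u : `|u| ^+ 2 <= dotp u u.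
Proof.
have d0 : 0 <= dotp u u by apply: sumr_ge0 => i _; rewrite -expr2 sqr_ge0.
suff h : `|u| <= Num.sqrt (dotp u u).
  by rewrite -[leRHS](sqr_sqrtr d0) lerXn2r // nnegrE ?sqrtr_ge0.
rewrite [leLHS]/Num.norm /= mx_normrE.
apply/bigmax_leP; split=> [|[i j] _ /=]; first exact: sqrtr_ge0.
rewrite -sqrtr_sqr ler_wsqrtr // ord1 /dotp (bigD1 j) //= -expr2 lerDl.
by apply: sumr_ge0 => k _; rewrite -expr2 sqr_ge0.
Qed.

Lemma cvg_dotp (T : Type) (F : set_system T) (FF : Filter F) (f g : T -> V) u v :
  f @ F --> u -> g @ F --> v -> (fun t => dotp (f t) (g t)) @ F --> dotp u v.
Proof.
move=> fu gv; apply: cvg_big => [|i _]; first exact: add_continuous.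
have c (w : V) : {for w, continuous (fun M : V => M ord0 i)} by exact: coord_continuous.
by apply: cvgM; [exact: continuous_cvg (c u) fu|exact: continuous_cvg (c v) gv].
Qed.

Lemma normr_comb_lt u v u' v' (t e : R) : 0 <= t -> t <= 1 ->
  `|u - u'| < e -> `|v - v'| < e ->
  `|((1 - t) *: u + t *: v) - ((1 - t) *: u' + t *: v')| < e.
Proof.
move=> t0 t1 ue ve.
have -> : (1 - t) *: u + t *: v - ((1 - t) *: u' + t *: v') =
    (1 - t) *: (u - u') + t *: (v - v').
  by apply/rowP => i; rewrite !mxE; ring.
apply: le_lt_trans (ler_normD _ _) _.
rewrite !normrZ (ger0_norm t0) ger0_norm ?subr_ge0 //.
have [->|tn0] := eqVneq t 0; first by rewrite mul0r subr0 mul1r addr0.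
have tp : 0 < t by rewrite lt_def tn0.
nra.
Qed.

Lemma bounded_normP (W : normedModType R) (A : set W) :
  bounded_set A <-> exists M, forall e : W, A e -> `|e| <= M.
Proof.
split=> [[M [_ hM]]|[M hM]].
  by exists (M + 1) => w Aw; apply: hM => //; rewrite ltrDl.
exists M; split; first exact: num_real.
by move=> r Mr w Aw; apply: le_trans (ltW Mr); exact: hM.
Qed.

Lemma closed_norm_le (W : normedModType R) (B : R) : closed [set w : W | `|w| <= B].
Proof.
apply: (closed_comp (f := fun w : W => `|w|) (D := [set r | r <= B])).
  by move=> w _; exact: norm_continuous.
exact: closed_le.
Qed.

(** A pair [(a, c)] at minimal distance exists, and first-order optimality makes [d := a - c] normal
    to a separating hyperplane. The ambient space is [V * R] because epigraphs are to be separated;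
    its norm is not Euclidean, so distance is measured with the inner product [ip]. *)
Lemma closed_convex_sep (A C : set (V * R)) :
  closed A -> A !=set0 ->
  (forall p q (t : R), A p -> A q -> 0 <= t -> t <= 1 -> A ((1 - t) *: p + t *: q)) ->
  compact C -> C !=set0 ->
  (forall p q (t : R), C p -> C q -> 0 <= t -> t <= 1 -> C ((1 - t) *: p + t *: q)) ->
  A `&` C = set0 ->
  exists (v : V) (be k : R), (forall p, A p -> k < dotp v p.1 + be * p.2) /\
    (forall p, C p -> dotp v p.1 + be * p.2 < k).
Proof.
move=> clA [a0 Aa0] cA cpC [c0 Cc0] cC AC0.
pose ip (p q : V * R) := dotp p.1 q.1 + p.2 * q.2.
have ip_norm p : `|p| ^+ 2 <= ip p p.
  have h1 : 0 <= dotp p.1 p.1 by apply: le_trans (norm_sqr_le_dotp _); exact: sqr_ge0.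
  rewrite prod_normE /ip -expr2; have [_|_] := leP `|p.1| `|p.2|.
    by rewrite real_normK ?num_real // lerDr.
  by apply: (le_trans (norm_sqr_le_dotp _)); rewrite lerDl sqr_ge0.
have ipD p q (t : R) : ip (p + t *: q) (p + t *: q) =
    ip p p + 2 * t * ip p q + t ^+ 2 * ip q q.
  by rewrite /ip /= !dotpE (dotpC q.1 p.1) /GRing.scale /=; ring.
pose f (r : (V * R) * (V * R)) := ip (r.1 - r.2) (r.1 - r.2).
have [M MC] : exists M, forall c, C c -> `|c| <= M.
  exact/bounded_normP/compact_bounded.
(* A point [a] that does at least as well as [(a0, c0)] has norm at most [B], so the minimum may be
   sought over a compact part of [A]. *)
pose B := M + f (a0, c0) + 1.
have f0 r : 0 <= f r by apply: le_trans (ip_norm _); exact: sqr_ge0.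
have cpA : compact (A `&` [set p | `|p| <= B]).
  have cpB : compact ([set v : V | `|v| <= B] `*` [set s : R | `|s| <= B]).
    apply: compact_setX.
      apply: bounded_closed_compact; first by apply/bounded_normP; exists B.
      exact: closed_norm_le.
    have -> : [set s : R | `|s| <= B] = `[- B, B]%classic.
      by apply/seteqP; split=> s /=; rewrite in_itv /= ler_norml.
    exact: segment_compact.
  apply: subclosed_compact cpB _.
    apply: closedI => //.
    exact: closed_norm_le.
  by move=> p [_ /=]; rewrite prod_normE ge_max => /andP[].
have M0 : 0 <= M by apply: le_trans (MC _ Cc0).
have normA a c : C c -> f (a, c) <= f (a0, c0) -> `|a| <= B.
  move=> Cc fac; have := le_trans (ip_norm (a - c)) fac.
  have := ler_normD (a - c) c; rewrite subrK.
  have := MC _ Cc; have := f0 (a0, c0); rewrite /B; nra.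
have fcont : continuous f.
  move=> r; have c0r : (r'.1 - r'.2) @[r' --> r] --> r.1 - r.2.
    by apply: cvgB; [exact: cvg_fst|exact: cvg_snd].
  have c1 : (r'.1 - r'.2).1 @[r' --> r] --> (r.1 - r.2).1.
    exact: cvg_comp c0r cvg_fst.
  have c2 : (r'.1 - r'.2).2 @[r' --> r] --> (r.1 - r.2).2.
    exact: cvg_comp c0r cvg_snd.
  by apply: cvgD; [exact: cvg_dotp|exact: cvgM].
have [[a c] /[!inE] -[[/= Aa _] Cc] fmin] := @compact_EVT_min _ _ f
   ((A `&` [set p | `|p| <= B]) `*` C)
   (ex_intro _ (a0, c0) (conj (conj Aa0 (normA a0 c0 Cc0 (lexx _))) Cc0))
   (compact_setX cpA cpC) (continuous_subspaceT fcont).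
have {}fmin a' c' : A a' -> C c' -> f (a, c) <= f (a', c').
  move=> Aa' Cc'; have [fl|fl] := leP (f (a', c')) (f (a0, c0)).
    by apply: fmin; rewrite inE; split=> //=; split=> //=; exact: normA fl.
  apply: le_trans (ltW fl); apply: fmin; rewrite inE; split=> //=; split=> //=.
  exact: normA Cc0 (lexx _).
pose d := a - c.
have dpos : 0 < ip d d.
  rewrite lt_def (f0 (a, c) : 0 <= ip d d) andbT; apply/eqP => d0.
  have : `|d| ^+ 2 <= 0 by rewrite -d0.
  rewrite exprn_even_le0 //= normr_eq0 subr_eq0 => /eqP ac.
  have : (A `&` C) c by split=> //; rewrite -ac.
  by rewrite AC0.
have lin0 (e : V * R) : (forall t : R, 0 <= t -> t <= 1 -> ip d d <= ip (d + t *: e) (d + t *: e)) ->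
    0 <= ip d e.
  move=> h; rewrite leNgt; apply/negP => de.
  have e0 : 0 <= ip e e by apply: le_trans (ip_norm _); exact: sqr_ge0.
  (* For this [t] the squared norm of [d + t e] changes by [2 t <d, e> + t^2 <e, e> = t (1 + t) <d,
     e> < 0]; the extra [- ip d e] in the denominator ensures [t <= 1]. *)
  pose t := - ip d e / (ip e e - ip d e).
  have den : 0 < ip e e - ip d e by lra.
  have t0 : 0 < t by rewrite divr_gt0 // oppr_gt0.
  have t1 : t <= 1 by rewrite ler_pdivrMr // mul1r; lra.
  have := h t (ltW t0) t1; rewrite ipD.
  have tE : t * (ip e e - ip d e) = - ip d e by rewrite /t divfK // gt_eqF.
  nra.
have hA a' : A a' -> 0 <= ip d (a' - a).
  move=> Aa'; apply: lin0 => t t0 t1.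
  have -> : d + t *: (a' - a) = (1 - t) *: a + t *: a' - c.
    by rewrite /d scalerBl scale1r scalerBr addrAC -!addrA; congr (_ + _);
       rewrite addrC -!addrA; congr (_ + _); rewrite addrC.
  by apply: (fmin _ c) => //; exact: cA.
have hC c' : C c' -> 0 <= ip d (c - c').
  move=> Cc'; apply: lin0 => t t0 t1.
  have -> : d + t *: (c - c') = a - ((1 - t) *: c + t *: c').
    by rewrite /d scalerBl scale1r scalerBr !opprD !opprK addrA -!addrA.
  by apply: (fmin a) => //; exact: cC.
exists d.1, d.2, ((ip d a + ip d c) / 2).
have ipB p q : ip d (p - q) = ip d p - ip d q.
  by rewrite /ip /= !dotpE; ring.
have dac : 0 < ip d a - ip d c by rewrite -ipB.
split=> p.
  by move=> /hA; rewrite ipB -/(ip d p); lra.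
by move=> /hC; rewrite ipB -/(ip d p); lra.
Qed.

End DotProduct.

(** * The polar *)

Section Polar.
Variables (R : realType) (N : nat).
Local Notation V := 'rV[R]_N.
Implicit Types (x y z u v w : V).

Definition ell x u : R := 1 - dotp u x.

Lemma ell_combr x u v (t : R) : ell x ((1 - t) *: u + t *: v) = (1 - t) * ell x u + t * ell x v.
Proof. by rewrite /ell !dotpE; ring. Qed.

Lemma ell0 x : ell x 0 = 1.
Proof. by rewrite /ell dotpE subr0. Qed.

Lemma cvg_ell (T : Type) (F : set_system T) (FF : Filter F) (f g : T -> V) x u :
  f @ F --> x -> g @ F --> u -> (fun t => ell (f t) (g t)) @ F --> ell x u.
Proof. by move=> fx gu; apply: cvgB; [exact: cvg_cst|exact: cvg_dotp]. Qed.

Lemma continuous_dotp x : continuous (fun u => dotp u x).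
Proof.
move=> u; apply: (@cvg_dotp R N V (nbhs u) _ id (cst x)); first exact: cvg_id.
exact: cvg_cst.
Qed.

Lemma continuous_ell x : continuous (ell x).
Proof.
move=> u; apply: (@cvg_ell V (nbhs u) _ (cst x) id); first exact: cvg_cst.
exact: cvg_id.
Qed.

Lemma ell_lipr x : exists2 c : R, 0 < c & forall u v, `|ell x u - ell x v| <= c * `|u - v|.
Proof.
exists (N.+1%:R * (`|x| + 1)); first by rewrite mulr_gt0 // ltr_wpDl.
move=> u v; have -> : ell x u - ell x v = - dotp (u - v) x by rewrite /ell !dotpE; ring.
rewrite normrN; apply: le_trans (norm_dotp_le _ _) _.
by rewrite mulrAC ler_wpM2r // ler_wpM2l // lerDl.
Qed.

Lemma closure_normP (A : set V) x :
  closure A x <-> forall e : R, 0 < e -> exists2 y, A y & `|x - y| < e.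
Proof.
split=> [Ax e e0|h B /nbhs_normP[e /= e0 hB]].
  have /Ax[y [Ay xy]] : nbhs x (ball x e) by exact: nbhsx_ballx.
  by exists y => //; move: xy; rewrite -ball_normE.
by have [y Ay xy] := h _ e0; exists y; split=> //; apply: hB.
Qed.

Lemma closure_convex (A : set V) : convex A -> convex (closure A).
Proof.
move=> cA x y t /closure_normP Ax /closure_normP Ay t0 t1; apply/closure_normP => e e0.
have [x' Ax' xx'] := Ax _ e0; have [y' Ay' yy'] := Ay _ e0.
exists ((1 - t) *: x' + t *: y'); first exact: cA.
exact: normr_comb_lt.
Qed.

Record bounded_convex_domain (D : set V) : Prop := BoundedConvexDomain {
  domain_bounded : bounded_set D;
  domain_convex : Defs.convex D;
  domain_open : open D;
  domain0 : D 0 }.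

Variable D : set V.
Hypothesis hD : bounded_convex_domain D.

Lemma domain_ball x : D x -> exists2 r : R, 0 < r & forall y, `|x - y| < r -> D y.
Proof.
move=> Dx; have : nbhs x D by apply: open_nbhs_nbhs; split=> //; exact: domain_open hD.
by move=> /nbhs_normP[r /= r0 hr]; exists r => // y xy; exact: hr.
Qed.

Lemma polar0 : polar D 0.
Proof. by move=> x _; rewrite dotpE. Qed.

Lemma polar_convex : convex (polar D).
Proof.
by move=> u v t Ku Kv t0 t1 x Dx; have := Ku x Dx; have := Kv x Dx; rewrite !dotpE; nra.
Qed.

Lemma polar_norm_le : exists2 B : R, 0 < B & forall u, polar D u -> `|u| <= B.
Proof.
have [r r0 hr] := domain_ball (domain0 hD).
exists (2 / r) => [|u Ku]; first by rewrite divr_gt0.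
have [->|u0] := eqVneq u 0; first by rewrite normr0 divr_ge0 // ltW.
have nu : 0 < `|u| by rewrite normr_gt0.
have /Ku : D ((r / 2 / `|u|) *: u).
  apply: hr; rewrite sub0r normrN normrZ ger0_norm ?divr_ge0 ?ltW //.
  by rewrite divfK ?gt_eqF // ltr_pdivrMr // ltr_pMr //; lra.
rewrite dotpE; have := norm_sqr_le_dotp u => h1 h2.
rewrite ler_pdivlMr //.
have h3 : r / 2 / `|u| * `|u| ^+ 2 <= 1.
  by apply: le_trans h2; rewrite ler_pM2l // !divr_gt0.
move: h3; rewrite expr2 mulrA divfK ?gt_eqF //; lra.
Qed.

Lemma polar_closed : closed (polar D).
Proof.
have -> : polar D = \bigcap_(x in D) [set u | dotp u x <= 1] by [].
apply: closed_bigI => x _; apply: (closed_comp (f := fun u => dotp u x) (D := [set s | s <= 1])).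
  by move=> u _; exact: continuous_dotp.
exact: closed_le.
Qed.

Lemma polar_compact : compact (polar D).
Proof.
apply: bounded_closed_compact polar_closed; apply/bounded_normP.
by have [B _ hB] := polar_norm_le; exists B.
Qed.

Lemma ell_lip : exists2 k : R, 0 < k & forall u x y, polar D u ->
  `|ell x u - ell y u| <= k * `|x - y|.
Proof.
have [B B0 hB] := polar_norm_le; exists (N.+1%:R * B); first by rewrite mulr_gt0.
move=> u x y Ku; have -> : ell x u - ell y u = - dotp u (x - y).
  by rewrite /ell !dotpE; ring.
rewrite normrN; apply: le_trans (norm_dotp_le _ _) _.
by apply: ler_wpM2r => //; apply: ler_wpM2l => //; exact: hB.
Qed.

(** Openness lets [x] be stretched to [(1 + e) x] in [D], so [<u, x> <= 1 / (1 + e)] uniformly in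
    [u]. *)
Lemma ell_ge_domain x : D x -> exists2 d : R, 0 < d & forall u, polar D u -> d <= ell x u.
Proof.
move=> Dx; have [r r0 hr] := domain_ball Dx.
pose e := r / (`|x| + 1) / 2.
have x1 : 0 < `|x| + 1 by rewrite ltr_wpDl.
have e0 : 0 < e by rewrite !divr_gt0.
exists (e / (1 + e)) => [|u Ku]; first by rewrite divr_gt0 // addr_gt0.
have /Ku : D ((1 + e) *: x).
  apply: hr; rewrite scalerDl scale1r opprD addNKr normrN normrZ gtr0_norm //.
  have : e * (`|x| + 1) = r / 2 by rewrite /e; field; rewrite gt_eqF.
  nra.
rewrite dotpE /ell ler_pdivrMr ?addr_gt0 //; nra.
Qed.

Lemma ell_ge0_closure x u : closure D x -> polar D u -> 0 <= ell x u.
Proof.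
move=> /closure_normP Dx Ku; rewrite leNgt; apply/negP => lx.
have [k k0 hk] := ell_lip.
have [y Dy xy] : exists2 y, D y & `|x - y| < - ell x u / k.
  by apply: Dx; rewrite divr_gt0 // oppr_gt0.
have := hk u x y Ku; have := Ku y Dy; rewrite ltr_pdivlMr // mulrC in xy.
rewrite ler_norml => ? /andP[]; rewrite {2}/ell; lra.
Qed.

(** Bipolar theorem for an open set. By compactness [ell x >= d > 0] on the polar; separation puts
    [(1 + d) x] in the closure of [D], and the room gained brings [x] itself into [D]. *)
Lemma bipolar x : (forall u, polar D u -> 0 < ell x u) -> D x.
Proof.
move=> lx.
have [u0 /[!inE] Ku0 hu0] : exists2 c, c \in polar D & forall u, u \in polar D -> ell x c <= ell x u.
  apply: compact_EVT_min; [by exists 0; exact: polar0|exact: polar_compact|].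
  apply: continuous_subspaceT => u.
  exact: continuous_ell.
pose d := ell x u0; have d0 : 0 < d by exact: lx.
have {}hu0 u : polar D u -> d <= ell x u by move=> Ku; apply: hu0; rewrite inE.
have : closure D ((1 + d) *: x).
  apply: contrapT => nDx.
  have [|||||||] := @closed_convex_sep R N [set p | closure D p.1] [set ((1 + d) *: x, 0)].
  - apply: (closed_comp (f := fst)); last exact: closed_closure.
    by move=> p _; exact: cvg_fst.
  - by exists (0, 0) => /=; apply: subset_closure; exact: domain0 hD.
  - by move=> p q t /= *; exact: closure_convex (domain_convex hD) _ _ _ _ _ _ _.
  - exact: compact_set1.
  - by exists ((1 + d) *: x, 0).
  - move=> p q t -> -> _ _ /=; rewrite -scalerDl subrK scale1r //.
  - by rewrite -subset0 => p [/= h pE]; apply: nDx; rewrite pE in h.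
  - move=> v [be [k [hA hC]]].
  have k0 : k < 0.
    have := hA (0, 0); rewrite /= dotpE mulr0 addr0; apply; apply: subset_closure.
    exact: domain0 hD.
  have Ku : polar D (k^-1 *: v).
    move=> y Dy; have := hA (y, 0); rewrite /= mulr0 addr0 dotpE => h.
    rewrite -ler_ndivrMl ?invrK ?mulr1; last by rewrite invr_lt0.
    by apply/ltW/h; exact: subset_closure.
  have := hu0 _ Ku; have := hC _ erefl; rewrite /= mulr0 addr0 /ell !dotpE.
  have kk : k^-1 * k = 1 by rewrite mulVf // lt_eqF.
  have : k^-1 < 0 by rewrite invr_lt0.
  move: (k^-1) kk => j; nra.
move=> /closure_normP hx; have [r r0 hr] := domain_ball (domain0 hD).
have [y Dy xy] := hx (d * r) (mulr_gt0 d0 r0).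
(* The error of [y] is rescaled so that [x] is a convex combination of [y] and [e] with weight
   [d / (1 + d)] on [e], while [e] stays in the ball of radius [r] around 0. *)
pose e := d^-1 *: ((1 + d) *: x - y).
have De : D e.
  apply: hr; rewrite sub0r normrN normrZ gtr0_norm ?invr_gt0 //.
  by rewrite mulrC ltr_pdivrMr // mulrC.
have d1 : 1 + d != 0 by rewrite gt_eqF // addr_gt0.
have -> : x = (1 - d / (1 + d)) *: y + (d / (1 + d)) *: e.
  by apply/rowP => i; rewrite !mxE; field; rewrite gt_eqF //=.
apply: (domain_convex hD) => //; first by apply: divr_ge0; lra.
by rewrite ler_pdivrMr; lra.
Qed.

(** Evaluation at 0 gives [k > 0], and division by [k] leaves some [ell x] positive on the polar, to
    which [bipolar] applies. Separating hyperplanes are turned into points of [D] this way. *)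
Lemma affine_ell (k : R) v : (forall u, polar D u -> 0 < k + dotp v u) ->
  exists c x, [/\ 0 < c, D x & forall u, k + dotp v u = c * ell x u].
Proof.
move=> h; have k0 : 0 < k by have := h 0 polar0; rewrite dotpE addr0.
have lE u : k + dotp v u = k * ell (- k^-1 *: v) u.
  by rewrite /ell !dotpE (dotpC u); field; rewrite gt_eqF.
exists k, (- k^-1 *: v); split=> //; apply: bipolar => u Ku.
by rewrite -(pmulr_rgt0 _ k0) -lE; exact: h.
Qed.

End Polar.

(** * Hilbert distance through the polar *)

Section Funk.
Variables (R : realType) (N : nat).
Local Notation V := 'rV[R]_N.
Implicit Types (x y z u v w : V).

(* The exponential of the Funk distance: for [x], [y] in [D] this is [|yz| / |xz|], where [z] is the
   boundary point on the ray from [y] through [x]. *)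
Definition funk (D : set V) y x : R := sup [set ell y u / ell x u | u in polar D].

Variable D : set V.
Hypothesis hD : bounded_convex_domain D.
Let M := funk D.

Lemma ell_gt0 x u : D x -> polar D u -> 0 < ell x u.
Proof. by move=> /(ell_ge_domain hD)[d d0 hd] Ku; apply: lt_le_trans (hd _ Ku). Qed.

(** The supremum is attained by compactness. The next two lemmas deduce that [M y x] is the least
    [c] with [ell y <= c * ell x] on the polar. *)
Lemma funk_max y x : D x -> exists2 u, polar D u &
  ell y u = M y x * ell x u /\ forall u', polar D u' -> ell y u' <= M y x * ell x u'.
Proof.
move=> Dx; pose f u := ell y u / ell x u.
have [u /[!inE] Ku hu] : exists2 c, c \in polar D & forall u, u \in polar D -> f u <= f c.
  apply: compact_EVT_max.
  - by exists 0; exact: polar0.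
  - exact: polar_compact hD.
  - rewrite continuous_subspace_in => u; rewrite inE => Ku.
    apply: continuous_subspaceT_for => //.
    have l0 : ell x u != 0 by rewrite gt_eqF // ell_gt0.
    exact: cvgM (@continuous_ell _ _ y u) (cvgV l0 (@continuous_ell _ _ x u)).
have {}hu u' : polar D u' -> f u' <= f u by move=> Ku'; apply: hu; rewrite inE.
have -> : M y x = f u.
  apply/eqP; rewrite eq_le; apply/andP; split.
    apply: ge_sup; first by exists (f u), u.
    by move=> _ [u' Ku' <-]; exact: hu.
  apply: ub_le_sup; last by exists u.
  by exists (f u) => _ [u' Ku' <-]; exact: hu.
exists u => //; split; first by rewrite /f divfK // gt_eqF // ell_gt0.
by move=> u' Ku'; rewrite -ler_pdivrMr ?ell_gt0 //; exact: hu.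
Qed.

Lemma funk_ell y x u : D x -> polar D u -> ell y u <= M y x * ell x u.
Proof. by move=> Dx Ku; have [_ _ [_ h]] := funk_max y Dx; exact: h. Qed.

Lemma funk_le y x (c : R) : D x -> (forall u, polar D u -> ell y u <= c * ell x u) ->
  M y x <= c.
Proof.
move=> Dx h; have [u Ku [e _]] := funk_max y Dx.
by have := h u Ku; rewrite e ler_pM2r // ell_gt0.
Qed.

Lemma funk_ge1 y x : D x -> 1 <= M y x.
Proof. by move=> Dx; have := funk_ell y Dx (@polar0 R N D); rewrite !ell0 mulr1. Qed.

Lemma funk_gt0 y x : D x -> 0 < M y x.
Proof. by move=> Dx; apply: lt_le_trans (funk_ge1 y Dx). Qed.

Lemma funk_triangle x y z : D y -> D z -> M x z <= M x y * M y z.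
Proof.
move=> Dy Dz; apply: funk_le => // u Ku; apply: le_trans (funk_ell x Dy Ku) _.
by rewrite -mulrA ler_pM2l ?funk_gt0 //; exact: funk_ell.
Qed.

Lemma funkxx x : D x -> M x x = 1.
Proof.
move=> Dx; apply/eqP; rewrite eq_le funk_ge1 // andbT.
by apply: funk_le => // u Ku; rewrite mul1r.
Qed.

Lemma ray_exit x v : D x -> v != 0 ->
  let s := sup [set t : R | 0 <= t /\ D (x + t *: v)] in
  [/\ 0 < s, forall u, polar D u -> s * dotp u v <= ell x u &
    exists2 u, polar D u & s * dotp u v = ell x u].
Proof.
move=> Dx v0 /=; set S := [set t | _]; set s := sup S.
have nv : 0 < `|v| by rewrite normr_gt0.
have hS : has_sup S.
  split; first by exists 0; split=> //=; rewrite scale0r addr0.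
  have /bounded_normP[B hB] := domain_bounded hD.
  exists ((B + `|x|) / `|v|) => t [t0 /hB h].
  rewrite ler_pdivlMr // -[t]ger0_norm // -normrZ.
  have -> : t *: v = (x + t *: v) - x by rewrite addrC addKr.
  by apply: le_trans (ler_normB _ _) _; rewrite lerD2r.
have ubS t : S t -> t <= s by move=> St; apply: (sup_upper_bound hS).
have [r r0 hr] := domain_ball hD Dx.
have s0 : 0 < s.
  apply: lt_le_trans (ubS (r / 2 / `|v|) _); first by rewrite !divr_gt0.
  split; first by rewrite !divr_ge0 // ltW.
  apply: hr; rewrite opprD addNKr normrN normrZ ger0_norm ?divr_ge0 ?ltW //.
  by rewrite divfK ?gt_eqF //; lra.
have lE u t : ell (x + t *: v) u = ell x u - t * dotp u v by rewrite /ell !dotpE; ring.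
have cl : closure D (x + s *: v).
  apply/closure_normP => e e0.
  have [t [t0 Dt] ts] := sup_adherent (divr_gt0 e0 nv) hS.
  exists (x + t *: v) => //.
  have -> : x + s *: v - (x + t *: v) = (s - t) *: v.
    by apply/rowP => i; rewrite !mxE; ring.
  rewrite normrZ ger0_norm ?subr_ge0 ?ubS //.
  by rewrite -ltr_pdivlMr //; rewrite -/s in ts; lra.
have h1 u : polar D u -> s * dotp u v <= ell x u.
  by move=> Ku; have := ell_ge0_closure hD cl Ku; rewrite lE subr_ge0.
split=> //; apply: contrapT => nu.
have Ds : D (x + s *: v).
  apply: (bipolar hD) => u Ku; rewrite lE subr_gt0 lt_neqAle h1 // andbT.
  by apply/eqP => e; apply: nu; exists u.
have [q q0 hq] := domain_ball hD Ds.
have t0 : 0 < q / 2 / `|v| by rewrite !divr_gt0.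
suff /ubS : S (s + q / 2 / `|v|) by lra.
split; first by rewrite addr_ge0 ?ltW // !divr_gt0.
apply: hq; have -> : x + s *: v - (x + (s + q / 2 / `|v|) *: v) = - ((q / 2 / `|v|) *: v).
  by apply/rowP => i; rewrite !mxE; ring.
rewrite normrN normrZ ger0_norm ?divr_ge0 ?ltW //.
by rewrite divfK ?gt_eqF //; lra.
Qed.

(** If [s] and [s'] are the exit times from [x] along [y - x] and its opposite, the maximal ratios
    are [s / (s - 1)] and [(1 + s') / s'], which are the length ratios [|zx| / |zy|] and
    [|wy| / |wx|]. *)
Lemma hilbert_distE x y : D x -> D y ->
  hilbert_dist D x y = ln (M x y) + ln (M y x).
Proof.
move=> Dx Dy; rewrite /hilbert_dist; case: eqVneq => [->|xy].
  by rewrite funkxx // ln1 addr0.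
have v0 : y - x != 0 by rewrite subr_eq0 eq_sym.
have v0' : - (y - x) != 0 by rewrite oppr_eq0.
rewrite /hilbert_z /hilbert_w.
have -> : [set t : R | 0 <= t /\ D (x - t *: (y - x))] =
    [set t | 0 <= t /\ D (x + t *: - (y - x))].
  by apply/seteqP; split=> t /=; rewrite scalerN.
have [s0 hs [u Ku us]] := ray_exit Dx v0.
have [s0' hs' [u' Ku' us']] := ray_exit Dx v0'.
set s := sup _ in s0 hs us *; set s' := sup _ in s0' hs' us' *.
set v := y - x in v0 v0' hs us hs' us' *.
have nv : 0 < `|v| by rewrite normr_gt0.
have lE w : ell y w = ell x w - dotp w v by rewrite /ell /v !dotpE; ring.
have lx := ell_gt0 Dx Ku; have ly := ell_gt0 Dy Ku.
have s1 : 1 < s by move: ly; rewrite lE -us -{2}[dotp u v]mul1r -mulrBl; nra.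
have Mxy : M x y = s / (s - 1).
  have s1' : 0 < s - 1 by rewrite subr_gt0.
  apply/eqP; rewrite eq_le; apply/andP; split.
    apply: funk_le => // w Kw; rewrite mulrAC ler_pdivlMr // lE.
    have := hs w Kw; lra.
  rewrite ler_pdivrMr //; have := funk_ell x Dy Ku; rewrite -/M lE -us.
  have : 0 < dotp u v by move: lx; rewrite -us pmulr_rgt0.
  move: (M x y) (dotp u v) => m a a0; nra.
have Myx : M y x = (1 + s') / s'.
  apply/eqP; rewrite eq_le; apply/andP; split.
    apply: funk_le => // w Kw; rewrite mulrAC ler_pdivlMr // lE.
    have := hs' w Kw; rewrite dotpE; lra.
  rewrite ler_pdivrMr //; have := funk_ell y Dx Ku'; rewrite -/M lE -us' dotpE.
  have : 0 < - dotp u' v by have := ell_gt0 Dx Ku'; rewrite -us' dotpE pmulr_rgt0.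
  move: (M y x) (dotp u' v) => m a a0; nra.
rewrite -lnM ?posrE ?funk_gt0 // Mxy Myx; congr ln.
have -> : x + s *: v - x = s *: v by rewrite addrC addKr.
have -> : x - s' *: v - x = - s' *: v by rewrite addrC addKr scaleNr.
have -> : x + s *: v - y = (s - 1) *: v by apply/rowP => i; rewrite !mxE; ring.
have -> : x - s' *: v - y = - (1 + s') *: v by apply/rowP => i; rewrite !mxE; ring.
rewrite !normrZ !normrN !gtr0_norm ?subr_gt0 ?addr_gt0 //.
by field; rewrite !gt_eqF // subr_gt0.
Qed.

Lemma funk_lip y : D y -> exists2 k : R, 0 < k & forall x x', M x y <= M x' y + k * `|x - x'|.
Proof.
move=> Dy; have [k k0 hk] := ell_lip hD; have [d d0 hd] := ell_ge_domain hD Dy.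
exists (k / d) => [|x x']; first exact: divr_gt0.
apply: funk_le => // u Ku; have := hk u x x' Ku; rewrite ler_norml => /andP[_ h1].
have h2 := funk_ell x' Dy Ku; have h3 := hd _ Ku.
have h4 : k * `|x - x'| <= k / d * `|x - x'| * ell y u.
  have -> : k / d * `|x - x'| * ell y u = k * `|x - x'| * (ell y u / d) by ring.
  apply: ler_peMr; first exact: mulr_ge0 (ltW k0) _.
  by rewrite ler_pdivlMr // mul1r.
rewrite -/M in h2; lra.
Qed.

Lemma cvg_funkl (T : Type) (F : set_system T) (FF : Filter F) (f : T -> V) x y :
  D y -> f @ F --> x -> (fun t => M (f t) y) @ F --> M x y.
Proof.
move=> Dy fx; have [k k0 hk] := funk_lip Dy.
apply/cvgrPdist_lt => e e0; have /cvgrPdist_lt/(_ _ (divr_gt0 e0 k0)) := fx.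
apply: filterS => t; rewrite ltr_pdivlMr // => h.
have := hk x (f t); have := hk (f t) x; rewrite distrC mulrC => h1 h2.
rewrite ltr_norml; apply/andP; split; lra.
Qed.

Lemma funk_near p (e : R) : D p -> 0 < e -> exists2 r : R, 0 < r & forall x, `|p - x| < r ->
  [/\ D x, M x p <= 1 + e & M p x <= 1 + e].
Proof.
move=> Dp e0; have [k k0 hk] := ell_lip hD; have [d d0 hd] := ell_ge_domain hD Dp.
have [r r0 hr] := domain_ball hD Dp.
(* Since [1 - e' = 1 / (1 + e)], a relative error [e'] between [ell p] and [ell x] yields both ratio
   bounds. *)
pose e' := e / (1 + e).
have e'e : e' * (1 + e) = e by rewrite /e' divfK // gt_eqF // addr_gt0.
have e'0 : 0 < e' by rewrite divr_gt0 // addr_gt0.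
exists (Num.min r (d * e' / k)) => [|x].
  by rewrite lt_min r0 /= divr_gt0 // mulr_gt0.
rewrite lt_min => /andP[xr]; rewrite ltr_pdivlMr // => xd.
have Dx := hr _ xr.
have h u : polar D u -> `|ell p u - ell x u| <= ell p u * e'.
  move=> Ku; have := hk u p x Ku; have := hd u Ku; nra.
split=> //; apply: funk_le => // u Ku; have := h u Ku; have := ell_gt0 Dp Ku;
  rewrite ler_norml => l0 /andP[]; nra.
Qed.

Lemma hilbert_dist_sym x y : D x -> D y -> hilbert_dist D x y = hilbert_dist D y x.
Proof. by move=> Dx Dy; rewrite !hilbert_distE // addrC. Qed.

Lemma hilbert_distxx x : hilbert_dist D x x = 0.
Proof. by rewrite /hilbert_dist eqxx. Qed.

Lemma hilbert_dist_triangle x y z : D x -> D y -> D z ->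
  hilbert_dist D x z <= hilbert_dist D x y + hilbert_dist D y z.
Proof.
move=> Dx Dy Dz; rewrite !hilbert_distE //.
have h a b c : D a -> D b -> D c -> ln (M a c) <= ln (M a b) + ln (M b c).
  move=> Da Db Dc; rewrite -lnM ?posrE ?funk_gt0 //.
  by rewrite ler_ln ?posrE ?mulr_gt0 ?funk_gt0 //; exact: funk_triangle.
have := h _ _ _ Dx Dy Dz; have := h _ _ _ Dz Dy Dx; lra.
Qed.

Lemma hilbert_dist_lip x y z : D x -> D y -> D z ->
  `|hilbert_dist D x z - hilbert_dist D y z| <= hilbert_dist D x y.
Proof.
move=> Dx Dy Dz; have h1 := hilbert_dist_triangle Dx Dy Dz.
have h2 := hilbert_dist_triangle Dy Dx Dz; rewrite (hilbert_dist_sym Dy Dx) in h2.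
by rewrite ler_norml lerNl opprB !lerBlDr h1 h2.
Qed.

Lemma hilbert_dist_near p (e : R) : D p -> 0 < e -> exists2 r : R, 0 < r &
  forall x, `|p - x| < r -> D x /\ hilbert_dist D p x < e.
Proof.
move=> Dp e0; have e3 : 0 < e / 3 by rewrite divr_gt0.
have [r r0 hr] := funk_near Dp e3.
exists r => // x /hr[Dx h1 h2]; split=> //.
have h a : 0 < a -> a <= 1 + e / 3 -> ln a <= e / 3.
  move=> a0 ae; apply: (@le_trans _ _ (ln (1 + e / 3))).
    by rewrite ler_ln ?posrE // addr_gt0.
  by apply: le_ln1Dx; lra.
rewrite hilbert_distE //.
have := h _ (funk_gt0 x Dp) h1; have := h _ (funk_gt0 p Dx) h2; lra.
Qed.

End Funk.

(** * Increasing choices and limits along ultrafilters *)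

Lemma increasing_choice (P : nat -> nat -> nat -> Prop) :
  (forall k m, exists2 n, (m < n)%N & P k m n) ->
  exists f : nat -> nat, forall k, (f k < f k.+1)%N /\ P k (f k) (f k.+1).
Proof.
move=> h; have h' : forall km : nat * nat, exists n, (km.2 < n)%N /\ P km.1 km.2 n.
  by move=> [k m]; have [n ? ?] := h k m; exists n.
have [s hs] := choice h'.
exists (fix f k := if k is k'.+1 then s (k', f k') else 0%N) => k.
exact: (hs (k, _)).
Qed.

Lemma ultra_nat : exists U : set_system nat, UltraFilter U /\ \oo `<=` U.
Proof. by have [U [UU oU]] := @ultraFilterLemma nat \oo _; exists U. Qed.

Lemma ultra_compact_cvg (T : topologicalType) (I : Type) (U : set_system I)
    (UU : UltraFilter U) (f : I -> T) (A : set T) :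
  compact A -> (\forall i \near U, A (f i)) -> exists2 p, A p & f @ U --> p.
Proof.
move=> cA UA; have [p [Ap clp]] := cA (f @ U) (fmap_proper_filter _ _) UA.
exists p => // C nC; have [//|UC] := in_ultra_setVsetC (f @^-1` C) UU.
by have [q [nCq Cq]] := clp (~` C) C UC nC.
Qed.

(** Every set of [U] meets every tail, so members can be picked one after the other at increasing
    indices. *)
Lemma ultra_subseq (U : set_system nat) (UU : ProperFilter U) (G : nat -> set nat) :
  \oo `<=` U -> (forall j, U (G j)) ->
  exists f : nat -> nat, (forall k, (f k < f k.+1)%N) /\ forall k, G k (f k).
Proof.
move=> oU UG; have [f hf] : exists f : nat -> nat,
    forall k, (f k < f k.+1)%N /\ G k (f k.+1).
  apply: (increasing_choice (P := fun k _ n => G k n)) => k m.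
  have Um : U [set n | (m < n)%N] by apply: oU; exact: nbhs_infty_gt.
  by have [n [Gn mn]] := filter_ex (filterI (UG k) Um); exists n.
by exists (fun k => f k.+1); split=> k; have [] := hf k; have [] := hf k.+1.
Qed.

(** * Epi-limits attached to horofunctions *)

Section Horofunction.
Variables (R : realType) (N : nat).
Local Notation V := 'rV[R]_N.
Implicit Types (y z u v w : V).

(* Normalized so that the minimum over [polar D] of its quotient by [ell b] is 1. *)
Definition scaled_ell (D : set V) (b z u : V) : R := funk D b z * ell z u.

(* The epigraph of the epi-limit along [U] of the functions [scaled_ell D b (x n)]; that this limit
   may be infinite is the reason for working with the epigraph. *)
Definition epilimit (D : set V) (b : V) (x : nat -> V) (U : set_system nat) : set (V * R) :=
  [set q | polar D q.1 /\ forall e : R, 0 < e -> \forall n \near U,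
    exists2 u, polar D u & `|q.1 - u| < e /\ scaled_ell D b (x n) u < q.2 + e].

(* What remains of [expR g] once the reverse Funk part, which depends on [p] only, is removed. *)
Definition funk_part (D : set V) (b p : V) (g : V -> R) (y : V) : R :=
  expR (g y) * funk D p b / funk D p y.

Variables (D : set V) (b p : V) (x : nat -> V) (U : set_system nat) (g : V -> R).
Hypotheses (hD : bounded_convex_domain D) (Db : D b) (Dx : forall n, D (x n)).
Context {UU : UltraFilter U}.
Hypothesis xp : x @ U --> p.
Hypothesis xg : forall y, D y ->
  (fun n => hilbert_dist D y (x n) - hilbert_dist D b (x n)) @ U --> g y.

Local Notation K := (polar D).
Local Notation A := (epilimit D b x U).
Local Notation G := (funk_part D b p g).

Lemma scaled_ell_ge z u : D z -> K u -> ell b u <= scaled_ell D b z u.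
Proof. exact: funk_ell. Qed.

Lemma scaled_ell_gt0 z u : D z -> K u -> 0 < scaled_ell D b z u.
Proof. by move=> Dz Ku; apply: lt_le_trans (scaled_ell_ge Dz Ku); exact: (ell_gt0 hD). Qed.

Lemma epilimit_up u (s s' : R) : A (u, s) -> s <= s' -> A (u, s').
Proof.
move=> [Ku h] ss'; split=> // e e0; apply: filterS (h e e0) => n [v Kv [uv l]].
by exists v => //; split=> //; apply: lt_le_trans l _; rewrite lerD2r.
Qed.

Lemma epilimit_closed : closed A.
Proof.
move=> [u s] cl; have near e : 0 < e -> exists2 q, A q & `|u - q.1| < e /\ `|s - q.2| < e.
  move=> e0; have /cl[q [Aq]] : nbhs (u, s) (ball (u, s) e) by exact: nbhsx_ballx.
  rewrite -ball_normE /= prod_normE gt_max => /andP[]; by exists q.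
split=> [|e e0].
  apply: (@polar_closed _ _ D); apply/closure_normP => e e0.
  by have [q [Kq _] []] := near e e0; exists q.1.
have [q [_ hq] [uq sq]] := near _ (divr_gt0 e0 (ltr0Sn R 1)).
apply: filterS (hq _ (divr_gt0 e0 (ltr0Sn R 1))) => n [v Kv [qv l]].
exists v => //; split.
  have -> : (u, s).1 - v = (u - q.1) + (q.1 - v) by rewrite /= addrA subrK.
  by apply: le_lt_trans (ler_normD _ _) _; lra.
by move: sq; rewrite ltr_norml => /andP[]; rewrite /=; lra.
Qed.

Lemma scaled_ell_comb z u v (t : R) : scaled_ell D b z ((1 - t) *: u + t *: v) =
  (1 - t) * scaled_ell D b z u + t * scaled_ell D b z v.
Proof. by rewrite /scaled_ell ell_combr; ring. Qed.

Lemma epilimit_convex (q r : V * R) (t : R) : A q -> A r -> 0 <= t -> t <= 1 ->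
  A ((1 - t) *: q + t *: r).
Proof.
move=> [Kq hq] [Kr hr] t0 t1; split; first exact: polar_convex.
move=> e e0; apply: filterS2 (hq e e0) (hr e e0) => n [u Ku [qu lu]] [v Kv [rv lv]].
exists ((1 - t) *: u + t *: v); first exact: polar_convex.
split; first exact: normr_comb_lt.
rewrite scaled_ell_comb /= /GRing.scale /=.
have [->|tn0] := eqVneq t 0; first by rewrite !mul0r subr0 !mul1r !addr0.
have tp : 0 < t by rewrite lt_def tn0.
nra.
Qed.

Lemma epilimit_ge u (s : R) : A (u, s) -> ell b u <= s.
Proof.
move=> [Ku h]; apply/ler_addgt0Pr => e e0.
have [B B0 hB] := ell_lipr b.
have e'0 : 0 < e / (1 + B) by rewrite divr_gt0 // addr_gt0.
have [n [v Kv [uv l]]] := filter_ex (h _ e'0).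
have := scaled_ell_ge (Dx n) Kv; have := hB u v; rewrite ler_norml => /andP[_ h1] h2.
have : e / (1 + B) * (1 + B) = e by rewrite divfK // gt_eqF // addr_gt0.
move: (e / (1 + B)) uv l e'0 => d /= uv l d0; nra.
Qed.

Lemma funk_part_gt0 y : D y -> 0 < G y.
Proof. by move=> Dy; rewrite divr_gt0 ?mulr_gt0 ?expR_gt0 ?funk_gt0. Qed.

(** The exponential of the Hilbert difference is the ratio of Funk parts times the ratio of reverse
    parts, and the latter converges because [x n] tends to [p]. *)
Lemma cvg_funk_part y : D y -> (fun n => funk D y (x n) / funk D b (x n)) @ U --> G y.
Proof.
move=> Dy.
have -> : (fun n => funk D y (x n) / funk D b (x n)) = (fun n =>
    expR (hilbert_dist D y (x n) - hilbert_dist D b (x n)) * funk D (x n) b / funk D (x n) y).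
  apply/funext => n; rewrite !(hilbert_distE hD) //.
  have My := funk_gt0 hD y (Dx n); have Mb := funk_gt0 hD b (Dx n).
  have My' := funk_gt0 hD (x n) Dy; have Mb' := funk_gt0 hD (x n) Db.
  by rewrite expRB !expRD !lnK ?posrE //; field; rewrite !gt_eqF.
apply: cvgM; last first.
  by apply: cvgV; [rewrite gt_eqF // (funk_gt0 hD)|exact: (cvg_funkl hD _ _ xp)].
apply: cvgM; last exact: (cvg_funkl hD _ _ xp).
by apply: continuous_cvg (xg Dy); exact: continuous_expR.
Qed.

(** On the polar, [ell y] is at most [funk D y (x n) / funk D b (x n)] times [scaled_ell D b (x n)],
    and the ratio tends to [G y]. With the next lemma, [G y] is the maximum of [ell y u / s] over
    the epigraph. *)
Lemma epilimit_le y u (s : R) : D y -> A (u, s) -> ell y u <= G y * s.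
Proof.
move=> Dy Aus; have [Ku h] := Aus.
have s0 : 0 < s by apply: lt_le_trans (epilimit_ge Aus); exact: (ell_gt0 hD).
have [B B0 hB] := ell_lipr y.
have Gy := funk_part_gt0 Dy.
rewrite leNgt; apply/negP => lt.
(* With [e <= 1], the product [e * c] bounds the sum of all errors: those from the Lipschitz
   constant, from [s], from [G y], and the term [e * e]. *)
pose c := B + s + G y + 1.
have c0 : 0 < c by rewrite /c; lra.
pose e := Num.min 1 ((ell y u - G y * s) / c / 2).
have d0 : 0 < (ell y u - G y * s) / c / 2 by rewrite !divr_gt0 // subr_gt0.
have e0 : 0 < e by rewrite lt_min ltr01.
have e1 : e <= 1 by rewrite ge_min lexx.
have ec : e * c < ell y u - G y * s.
  have : e <= (ell y u - G y * s) / c / 2 by rewrite ge_min lexx orbT.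
  rewrite ler_pdivlMr // ler_pdivlMr //; nra.
have /cvgrPdist_lt/(_ _ e0) := cvg_funk_part Dy.
move=> Ue; have [n [hn [v Kv [uv l]]]] := filter_ex (filterI Ue (h _ e0)).
have Mb := funk_gt0 hD b (Dx n).
have h1 : ell y v <= funk D y (x n) / funk D b (x n) * scaled_ell D b (x n) v.
  rewrite /scaled_ell mulrA divfK ?gt_eqF //; exact: (funk_ell hD).
have a0 := scaled_ell_gt0 (Dx n) Kv.
have := hB u v; rewrite ler_norml => /andP[_ h2].
move: hn; rewrite distrC ltr_norml => /andP[_ h3].
move: l h1 h3 a0 uv => /=.
move: (funk D y (x n) / funk D b (x n)) (scaled_ell D b (x n) v) => m a l h1 h3 a0 uv.
have h4 : m * a <= (G y + e) * a by rewrite ler_wpM2r //; lra.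
have h5 : (G y + e) * a <= (G y + e) * (s + e) by rewrite ler_wpM2l //; lra.
have h6 : B * `|u - v| <= B * e by rewrite ler_wpM2l // ltW.
rewrite /c in ec; nra.
Qed.

(** The point [u] is the limit along [U] of maximisers of [ell y / ell (x n)]. *)
Lemma epilimit_attain y : D y -> exists u, A (u, ell y u / G y).
Proof.
move=> Dy; have Gy := funk_part_gt0 Dy.
have /choice[v hv] : forall n, exists u, K u /\ ell y u = funk D y (x n) * ell (x n) u.
  by move=> n; have [u Ku [e _]] := funk_max hD y (Dx n); exists u.
have [u Ku vu] : exists2 u, K u & v @ U --> u.
  by apply: ultra_compact_cvg (polar_compact hD) _; apply: nearW => n; have [] := hv n.
exists u; split=> // e e0.
have lim : (fun n => ell y (v n) / (funk D y (x n) / funk D b (x n))) @ U --> ell y u / G y.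
  apply: cvgM; first by apply: cvg_ell => //; exact: cvg_cst.
  by apply: cvgV; [rewrite gt_eqF|exact: cvg_funk_part].
move/cvgrPdist_lt/(_ _ e0): lim; move/cvgrPdist_lt/(_ _ e0): vu.
apply: filterS2 => n uv l; have [Kv ev] := hv n; exists (v n) => //; split=> //=.
have My := funk_gt0 hD y (Dx n); have Mb := funk_gt0 hD b (Dx n).
have -> : scaled_ell D b (x n) (v n) = ell y (v n) / (funk D y (x n) / funk D b (x n)).
  by rewrite ev /scaled_ell; field; rewrite !gt_eqF.
by move: l; rewrite distrC ltr_norml => /andP[_]; lra.
Qed.

(** The epigraph is closed upwards and [C] has a point over every point of [K], so the separating
    hyperplane is not vertical and [be > 0]. Since those points have nonnegative height, the affine
    function obtained is positive on [K], hence of the form [c * ell z]. *)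
Lemma epilimit_sep (C : set (V * R)) : compact C ->
  (forall q r (t : R), C q -> C r -> 0 <= t -> t <= 1 -> C ((1 - t) *: q + t *: r)) ->
  (forall u, K u -> exists2 s : R, 0 <= s & C (u, s)) -> A `&` C = set0 ->
  exists (c : R) z, [/\ 0 < c, D z, forall q, C q -> q.2 < c * ell z q.1 &
    forall q, A q -> c * ell z q.1 < q.2].
Proof.
move=> cpC cC vC AC0; have [u0 Au0] := epilimit_attain Db; have Ku0 := Au0.1.
have [s0 s00 Cs0] := vC _ Ku0.
have [v [be [k [hA hC]]]] := closed_convex_sep epilimit_closed (ex_intro _ _ Au0) epilimit_convex
   cpC (ex_intro _ _ Cs0) cC AC0.
have be0 : 0 < be.
  have := hC _ Cs0; set s1 := Num.max (ell b u0 / G b) (s0 + 1).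
  have s1s : s0 < s1 by rewrite lt_max ltrDl ltr01 orbT.
  have /hA : A (u0, s1) by apply: epilimit_up Au0 _; rewrite le_max lexx.
  rewrite /=; nra.
have hp u : K u -> 0 < k / be + dotp (- be^-1 *: v) u.
  move=> Ku; have [s s_ge0 /hC /= h] := vC _ Ku; rewrite dotpE.
  have -> : k / be + - be^-1 * dotp v u = (k - dotp v u) / be by field; rewrite gt_eqF.
  by rewrite divr_gt0 //; nra.
have [c [z [c0 Dz cz]]] := affine_ell hD hp.
have {}cz u : c * ell z u = (k - dotp v u) / be.
  by rewrite -cz dotpE; field; rewrite gt_eqF.
exists c, z; split=> // q.
  by move=> /hC h; rewrite cz ltr_pdivlMr //; lra.
by move=> /hA h; rewrite cz ltr_pdivrMr //; lra.
Qed.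

End Horofunction.

(** * Stability implies the Busemann property *)

Section Join.
Variables (R : realType) (W : normedModType R).
Implicit Types (p q : W) (A B : set W).

(** For nonempty convex [A] and [B] this is the convex hull of their union. *)
Definition join A B : set W :=
  [set r | exists (t : R) p q, [/\ 0 <= t <= 1, A p, B q & r = (1 - t) *: p + t *: q]].

(** Convexity in any normed space, as required for subsets of [V * R]; [convex] concerns row vectors
    only. *)
Definition stable_comb A := forall p q (t : R), A p -> A q -> 0 <= t -> t <= 1 ->
  A ((1 - t) *: p + t *: q).

Lemma stable_comb_cone A p q (a c : R) : stable_comb A -> A p -> A q -> 0 <= a -> 0 <= c ->
  exists2 r, A r & a *: p + c *: q = (a + c) *: r.
Proof.
move=> cA Ap Aq a0 c0; have [/eqP|ac0] := eqVneq (a + c) 0.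
  rewrite paddr_eq0 // => /andP[/eqP -> /eqP ->].
  by exists p => //; rewrite addr0 !scale0r addr0.
exists ((1 - c / (a + c)) *: p + (c / (a + c)) *: q).
  have acp : 0 < a + c by rewrite lt_def ac0 addr_ge0.
  by apply: cA => //; rewrite ?divr_ge0 ?addr_ge0 // ler_pdivrMr // mul1r lerDr.
by rewrite scalerDr !scalerA; congr (_ *: _ + _ *: _); field.
Qed.

Lemma join_stable_comb A B : stable_comb A -> stable_comb B -> stable_comb (join A B).
Proof.
move=> cA cB _ _ s [t [p [q [/andP[t0 t1] Ap Bq ->]]]] [t' [p' [q' [/andP[t'0 t'1] Ap' Bq' ->]]]] s0 s1.
have s1' : 0 <= 1 - s by rewrite subr_ge0.
have [p'' Ap'' pE] := stable_comb_cone cA Ap Ap' (mulr_ge0 s1' (etrans (subr_ge0 _ _) t1))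
   (mulr_ge0 s0 (etrans (subr_ge0 _ _) t'1)).
have [q'' Bq'' qE] := stable_comb_cone cB Bq Bq' (mulr_ge0 s1' t0) (mulr_ge0 s0 t'0).
exists ((1 - s) * t + s * t'), p'', q''; split=> //; first by apply/andP; split; nra.
rewrite -qE; have -> : 1 - ((1 - s) * t + s * t') = (1 - s) * (1 - t) + s * (1 - t') by ring.
by rewrite -pE !scalerDr !scalerA addrACA.
Qed.

Lemma join_compact A B : compact A -> compact B -> compact (join A B).
Proof.
move=> cA cB.
pose f (r : R * (W * W)) : W := (1 - r.1) *: r.2.1 + r.1 *: r.2.2.
have -> : join A B = [set f r | r in `[0, 1]%classic `*` (A `*` B)].
  apply/seteqP; split=> r.
    by move=> [t [p [q [t01 Ap Bq ->]]]]; exists (t, (p, q)); rewrite //= in_itv.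
  move=> [[t [p q]] [/= +] [Ap Bq] <-]; rewrite in_itv /= => t01.
  by exists t, p, q.
apply: continuous_compact; last exact: compact_setX (@segment_compact _ _ _) (compact_setX cA cB).
apply: continuous_subspaceT => r.
have c1 : r'.1 @[r' --> r] --> r.1 by exact: cvg_fst.
have c2 : r'.2 @[r' --> r] --> r.2 by exact: cvg_snd.
have c21 : r'.2.1 @[r' --> r] --> r.2.1 by exact: cvg_comp c2 cvg_fst.
have c22 : r'.2.2 @[r' --> r] --> r.2.2 by exact: cvg_comp c2 cvg_snd.
by apply: cvgD; apply: cvgZ => //; apply: cvgB => //; exact: cvg_cst.
Qed.

End Join.

Lemma rat_row_dense (R : realType) (N : nat) (y : 'rV[R]_N) (r : R) : 0 < r ->
  exists q : 'rV[rat]_N, `|y - map_mx ratr q| < r.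
Proof.
move=> r0; have /choice[f hf] : forall i, exists c : rat, ratr c \in `]y ord0 i - r, y ord0 i[.
  by move=> i; apply: rat_in_itvoo; lra.
exists (\row_i f i); rewrite [ltLHS]/Num.norm /= mx_normrE.
apply/bigmax_ltP; split=> // -[i j] _ /=; rewrite ord1 !mxE.
have := hf j; rewrite in_itv /= => /andP[h1 h2].
by rewrite ltr_norml; apply/andP; split; lra.
Qed.

Lemma ex_invr_lt (R : realType) (e : R) : 0 < e -> exists k : nat, k.+1%:R^-1 < e.
Proof.
move=> e0; have [k _ h] := near_infty_natSinv_lt (PosNum e0).
by exists k; apply: h => /=.
Qed.

Section Directed.
Variables (R : realType) (N : nat).
Local Notation V := 'rV[R]_N.
Implicit Types (y z u v w : V).

Definition stable_convex (K : set V) := forall u v (t : R), K u -> K v -> 0 < t -> t < 1 ->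
  forall r : R, 0 < r -> exists2 rho : R, 0 < rho & forall w, K w ->
    `|((1 - t) *: u + t *: v) - w| < rho ->
    exists u' v', [/\ K u', K v', `|u - u'| < r, `|v - v'| < r & w = (1 - t) *: u' + t *: v'].

Variables (D : set V) (b p : V) (x : nat -> V) (U : set_system nat) (g : V -> R).
Hypotheses (hD : bounded_convex_domain D) (Db : D b) (Dx : forall n, D (x n)).
Context {UU : UltraFilter U}.
Hypothesis xp : x @ U --> p.
Hypothesis xg : forall y, D y ->
  (fun n => hilbert_dist D y (x n) - hilbert_dist D b (x n)) @ U --> g y.
Hypothesis sK : stable_convex (polar D).

Local Notation K := (polar D).
Local Notation A := (epilimit D b x U).
Local Notation G := (funk_part D b p g).

(** An ultrafilter contains a set or its complement, so failure of the epigraph condition at one [e]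
    gives a lower bound near [u] for [U]-almost all [n]. *)
Lemma not_epilimit u (s : R) : K u -> ~ A (u, s) -> exists2 e : R, 0 < e &
  \forall n \near U, forall v, K v -> `|u - v| < e -> s + e <= scaled_ell D b (x n) v.
Proof.
move=> Ku nA; apply: contrapT => h; apply: nA; split=> // e e0.
pose P := [set n | exists2 v, K v & `|u - v| < e /\ scaled_ell D b (x n) v < s + e].
have [//|UnP] := in_ultra_setVsetC P UU.
case: h; exists e => //; apply: filterS UnP => n nP v Kv uv.
by rewrite leNgt; apply/negP => l; apply: nP; exists v.
Qed.

(* Convexity of the epigraph together with convexity of its complement says that the epi-limit is
   affine. *)
Lemma epilimit_compl_convex u v (s1 s2 t : R) : K u -> K v -> ~ A (u, s1) -> ~ A (v, s2) ->
  0 <= t -> t <= 1 -> ~ A ((1 - t) *: u + t *: v, (1 - t) * s1 + t * s2).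
Proof.
move=> Ku Kv nu nv t0 t1.
have [->|tn0] := eqVneq t 0.
  by rewrite subr0 !scale1r !scale0r mul1r mul0r !addr0.
have [->|tn1] := eqVneq t 1.
  by rewrite subrr !scale1r !scale0r mul1r mul0r !add0r.
have tp : 0 < t by rewrite lt_def tn0.
have tl : t < 1 by rewrite lt_neqAle tn1.
have [e1 e10 h1] := not_epilimit Ku nu; have [e2 e20 h2] := not_epilimit Kv nv.
pose e := Num.min e1 e2.
have e0 : 0 < e by rewrite lt_min e10.
have [ee1 ee2] : e <= e1 /\ e <= e2 by rewrite !ge_min !lexx orbT.
have [rho rho0 hrho] := sK Ku Kv tp tl e0.
move=> [_ h]; have r0 : 0 < Num.min rho e by rewrite lt_min rho0.
have [n [[hn1 hn2] [w Kw [+ +]]]] := filter_ex (filterI (filterI h1 h2) (h _ r0)).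
rewrite lt_min => /andP[/= hw _] lw.
have [u' [v' [Ku' Kv' uu' vv' wE]]] := hrho _ Kw hw.
have l1 := hn1 _ Ku' (lt_le_trans uu' ee1); have l2 := hn2 _ Kv' (lt_le_trans vv' ee2).
have : Num.min rho e <= e by rewrite ge_min lexx orbT.
move: lw; rewrite wE scaled_ell_comb; nra.
Qed.

(** The pair [(c, z)] stands for the affine function [c * ell z]; the inequality is strict, as
    [epilimit_sep] delivers it. *)
Definition epi_minorant (cz : R * V) :=
  [/\ 0 < cz.1, D cz.2 & forall q, A q -> cz.1 * ell cz.2 q.1 < q.2].

Lemma continuous_graph (c : R) z : continuous (fun u : V => (u, c * ell z u)).
Proof.
move=> u; have h1 : v @[v --> u] --> u by exact: cvg_id.
have h2 : c * ell z v @[v --> u] --> c * ell z u.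
  by apply: (@cvgM R V (nbhs u) _ (cst c) (ell z)); [exact: cvg_cst|exact: continuous_ell].
exact: cvg_pair h1 h2.
Qed.

(** The join of the two graphs misses the epigraph because the complement of the epigraph is convex;
    a function separating them lies above both graphs. *)
Lemma epi_minorant_directed cz1 cz2 : epi_minorant cz1 -> epi_minorant cz2 ->
  exists2 cz, epi_minorant cz & forall u, K u ->
    cz1.1 * ell cz1.2 u <= cz.1 * ell cz.2 u /\ cz2.1 * ell cz2.2 u <= cz.1 * ell cz.2 u.
Proof.
pose gr (cz : R * V) := [set (u, cz.1 * ell cz.2 u) | u in K].
have grc cz : compact (gr cz).
  apply: continuous_compact (polar_compact hD).
  by apply: continuous_subspaceT; exact: continuous_graph.
have grs cz : stable_comb (gr cz).
  move=> _ _ t [u Ku <-] [v Kv <-] t0 t1; exists ((1 - t) *: u + t *: v).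
    exact: polar_convex.
  by rewrite ell_combr; congr pair; rewrite /= /GRing.scale /=; ring.
move=> [c10 Dz1 h1] [c20 Dz2 h2].
have sub u : K u -> join (gr cz1) (gr cz2) (u, cz1.1 * ell cz1.2 u).
  move=> Ku; exists 0, (u, cz1.1 * ell cz1.2 u), (u, cz2.1 * ell cz2.2 u).
  by split; [rewrite lexx ler01|exists u|exists u|rewrite subr0 scale1r scale0r addr0].
have sub2 u : K u -> join (gr cz1) (gr cz2) (u, cz2.1 * ell cz2.2 u).
  move=> Ku; exists 1, (u, cz1.1 * ell cz1.2 u), (u, cz2.1 * ell cz2.2 u).
  by split; [rewrite lexx ler01|exists u|exists u|rewrite subrr scale1r scale0r add0r].
have [||u Ku||c [z [c0 Dz hC hA]]] := epilimit_sep hD Db Dx xp xg (C := join (gr cz1) (gr cz2)).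
- exact: join_compact.
- exact: join_stable_comb.
- exists (cz1.1 * ell cz1.2 u); last exact: sub.
  by rewrite mulr_ge0 // ltW // (ell_gt0 hD).
- rewrite -subset0 => q [Aq [t [_ [_ [/andP[t0 t1] [u Ku <-] [v Kv <-] qE]]]]].
  apply: (@epilimit_compl_convex u v (cz1.1 * ell cz1.2 u) (cz2.1 * ell cz2.2 v) t) => //.
  + by move=> /h1; rewrite ltxx.
  + by move=> /h2; rewrite ltxx.
  + by move: Aq; rewrite qE.
exists (c, z) => // u Ku.
by split; apply/ltW; [apply: (hC _ (sub u Ku))|apply: (hC _ (sub2 u Ku))].
Qed.

Lemma epi_minorantP y (k : R) : D y -> 0 < k -> epi_minorant ((G y + k)^-1, y).
Proof.
move=> Dy k0; have Gy := funk_part_gt0 p g hD Db Dy.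
have Gk : 0 < G y + k by rewrite addr_gt0.
split=> //= [|[u s] Aq /=]; first by rewrite invr_gt0.
have s0 : 0 < s by apply: lt_le_trans (epilimit_ge hD Dx Aq); exact: (ell_gt0 hD Db Aq.1).
rewrite ltr_pdivrMl //; apply: le_lt_trans (epilimit_le hD Db Dx xp xg Dy Aq) _.
by rewrite ltr_pM2r // ltrDl.
Qed.

(** The bound on [G y'] comes from a point of the epigraph at which [G y'] is attained, tested
    against [y]. *)
Lemma funk_part_near y (e : R) : D y -> 0 < e -> exists2 r : R, 0 < r & forall y', `|y - y'| < r ->
  [/\ D y', G y' <= (1 + e) * G y & forall u, K u -> ell y u <= (1 + e) * ell y' u].
Proof.
move=> Dy e0; have [r r0 hr] := funk_near hD Dy e0.
exists r => // y' /hr[Dy' h1 h2]; split=> //.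
  have [u Au] := epilimit_attain hD Db Dx xp xg Dy'.
  have Gy := funk_part_gt0 p g hD Db Dy; have Gy' := funk_part_gt0 p g hD Db Dy'.
  have h3 : ell y u * G y' <= G y * ell y' u.
    by rewrite -ler_pdivlMr // -mulrA; exact: epilimit_le Au.
  have Ku : K u by exact: Au.1.
  have ly := ell_gt0 hD Dy Ku; have h4 := funk_ell hD y' Dy Ku.
  rewrite -(ler_pM2l ly); apply: le_trans h3 _.
  have h5 : ell y' u <= (1 + e) * ell y u by apply: le_trans h4 _; rewrite ler_pM2r.
  have := ler_wpM2l (ltW Gy) h5; lra.
move=> u Ku; apply: le_trans (funk_ell hD y Dy' Ku) _.
by rewrite ler_pM2r // (ell_gt0 hD).
Qed.

(** The minorants attached to rational points and precisions [1 / (k + 1)] are countably many;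
    directedness gives an increasing sequence that dominates each of them in turn, and density
    covers the other [y]. *)
Lemma epi_minorant_seq : exists h : nat -> R * V, (forall n, epi_minorant (h n)) /\
  forall y (e : R), D y -> 0 < e -> \forall n \near \oo, forall u, K u ->
    ell y u <= (G y + e) * ((h n).1 * ell (h n).2 u).
Proof.
(* The index decodes to a precision and a rational point; [b] is the default when decoding fails or
   the point lies outside [D]. *)
pose target (n : nat) : R * V := if unpickle n is Some (k, q) then
  let y := map_mx ratr (q : 'rV[rat]_N) : V in
  if `[< D y >] then ((G y + k.+1%:R^-1)^-1, y) else ((G b + 1)^-1, b)
  else ((G b + 1)^-1, b).
have tP n : epi_minorant (target n).
  rewrite /target; case: unpickle => [[k q]|]; last exact: epi_minorantP.
  by case: asboolP => [Dq|_]; apply: epi_minorantP => //; rewrite invr_gt0.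
have /choice[f hf] : forall ncz : nat * (R * V), exists cz, epi_minorant ncz.2 ->
    epi_minorant cz /\ forall u, K u -> ncz.2.1 * ell ncz.2.2 u <= cz.1 * ell cz.2 u /\
      (target ncz.1).1 * ell (target ncz.1).2 u <= cz.1 * ell cz.2 u.
  move=> [n cz]; have [h|nh] := pselect (epi_minorant cz); last by exists cz.
  by have [cz' ? ?] := epi_minorant_directed h (tP n); exists cz'.
pose h := fix h n := if n is n'.+1 then f (n', h n') else target 0%N.
have hP n : epi_minorant (h n) by elim: n => [|n IH]; [exact: tP|exact: (hf (n, h n) IH).1].
have hstep n u : K u -> (h n).1 * ell (h n).2 u <= (h n.+1).1 * ell (h n.+1).2 u /\
    (target n).1 * ell (target n).2 u <= (h n.+1).1 * ell (h n.+1).2 u.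
  by move=> Ku; exact: (hf (n, h n) (hP n)).2.
have hmon m n u : K u -> (m <= n)%N -> (h m).1 * ell (h m).2 u <= (h n).1 * ell (h n).2 u.
  move=> Ku /subnK <-; elim: (n - m)%N => [|d IH]; first by rewrite add0n.
  by apply: le_trans IH _; rewrite addSn; exact: (hstep _ _ Ku).1.
exists h; split=> // y e Dy e0.
have Gy := funk_part_gt0 p g hD Db Dy.
(* This gives [(1 + d)^2 * G y <= G y + e / 2]; the other half of [e] absorbs
   [(1 + d) / (k + 1)]. *)
pose d := Num.min 1 (e / (6 * G y)).
have d'0 : 0 < e / (6 * G y) by rewrite divr_gt0 // mulr_gt0.
have d0 : 0 < d by rewrite lt_min ltr01.
have d1 : d <= 1 by rewrite ge_min lexx.
have dG : d * (6 * G y) <= e.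
  have G6 : 0 < 6 * G y by rewrite mulr_gt0.
  by rewrite -ler_pdivlMr // ge_min lexx orbT.
have [r r0 hr] := funk_part_near Dy d0.
have [q /hr[Dq Gq lq]] := rat_row_dense y r0.
have [k hk] : exists k : nat, k.+1%:R^-1 < e / 4 by apply: ex_invr_lt; rewrite divr_gt0.
pose n0 := pickle (k, q).
exists n0.+1 => // n /= n0n u Ku.
have tE : target n0 = ((G (map_mx ratr q) + k.+1%:R^-1)^-1, map_mx ratr q).
  by rewrite /target /n0 pickleK; case: asboolP.
have := hmon _ _ _ Ku n0n; have := (hstep n0 _ Ku).2; rewrite tE [(_, _).1]/= [(_, _).2]/=.
have Gq0 := funk_part_gt0 p g hD Db Dq.
have k0 : 0 < k.+1%:R^-1 :> R by rewrite invr_gt0.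
have a0 : 0 < (h n).1 * ell (h n).2 u.
  by have [c0 Dz _] := hP n; rewrite mulr_gt0 // (ell_gt0 hD).
rewrite ler_pdivrMl ?addr_gt0 // => h1 h2.
have {h1 h2} h3 : ell (map_mx ratr q) u <= (G (map_mx ratr q) + k.+1%:R^-1) * ((h n).1 * ell (h n).2 u).
  by apply: le_trans h1 _; rewrite ler_pM2l ?addr_gt0.
apply: le_trans (lq u Ku) _.
move: ((h n).1 * ell (h n).2 u) (ell (map_mx ratr q) u) a0 h3 => a l a0 h3.
move: Gq h3 Gq0; move: (G _) (G y) dG Gy (k.+1%:R^-1) k0 hk => G1 G0 dG Gy j k0 hk Gq h3 Gq0.
have h4 : (1 + d) * l <= (1 + d) * ((G1 + j) * a) by rewrite ler_wpM2l //; lra.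
apply: le_trans h4 _; rewrite mulrA ler_pM2r //.
have h5 : (1 + d) * G1 <= (1 + d) * ((1 + d) * G0) by rewrite ler_wpM2l //; lra.
nra.
Qed.

End Directed.

(** * Almost-geodesics and the defect [d b (x n) + g (x n)] *)

Section DistanceSequences.
Variables (R : realType) (T : Type) (P : T -> Prop) (d : T -> T -> R) (b : T) (g : T -> R).
Hypothesis d_refl : forall x, d x x = 0.
Hypothesis d_tri : forall x y z, P x -> P y -> P z -> d x z <= d x y + d y z.
Variable x : nat -> T.
Hypotheses (Pb : P b) (Px : forall n, P (x n)).
Hypothesis xg : forall y, P y -> (fun n => d y (x n) - d b (x n)) @ \oo --> g y.

Lemma limit_lip y z : P y -> P z -> g y - g z <= d y z.
Proof.
move=> Py Pz; apply: cvgr_to_le (cvgB (xg Py) (xg Pz)) _.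
apply: nearW => n; rewrite !fctE; have := d_tri Py Pz (Px n); lra.
Qed.

(** Each new index is taken so far out that the step length is at most the drop of [g] plus
    [2^-(k+1)]. The steps telescope with total error below 1, and the total drop of [g] is at most
    the distance between the end points. *)
Lemma almost_geodesic_subseq :
  (forall e : R, 0 < e -> \forall n \near \oo, d b (x n) + g (x n) <= e) ->
  exists f : nat -> nat, (forall k, (f k < f k.+1)%N) /\
    forall l, \sum_(1 <= i < l.+1) d (x (f i.-1)) (x (f i)) <= d (x (f 0%N)) (x (f l)) + 1.
Proof.
move=> small.
have [f hf] : exists f : nat -> nat, forall k, (f k < f k.+1)%N /\
    d (x (f k)) (x (f k.+1)) + g (x (f k.+1)) <= g (x (f k)) + 2^-1 ^+ k.+1.
  apply: (increasing_choice (P := fun k m n => d (x m) (x n) + g (x n) <= g (x m) + 2^-1 ^+ k.+1)).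
  move=> k m; have e0 : 0 < 2^-1 ^+ k.+1 / 2 :> R by rewrite divr_gt0 // exprn_gt0.
  have h1 := small _ e0; have /cvgrPdist_lt/(_ _ e0) h2 := xg (Px m).
  have h3 : \forall n \near \oo, (m < n)%N by exact: nbhs_infty_gt.
  have [n [[n1 n2] n3]] := filter_ex (filterI (filterI h1 h2) h3).
  exists n => //; move: n2; rewrite ltr_norml => /andP[]; lra.
exists f; split=> [k|l]; first by have [] := hf k.
suff h : \sum_(1 <= i < l.+1) d (x (f i.-1)) (x (f i)) <=
    g (x (f 0%N)) - g (x (f l)) + (1 - 2^-1 ^+ l).
  apply: le_trans h _; have := limit_lip (Px (f 0%N)) (Px (f l)).
  have : 0 <= 2^-1 ^+ l :> R by rewrite exprn_ge0.
  lra.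
elim: l => [|l IH]; first by rewrite big_geq // expr0; lra.
rewrite big_nat_recr //= ; have [_] := hf l; rewrite exprS.
move: IH; set S := \sum_(_ <= _ < _) _; lra.
Qed.

(** The excess [E] of length over distance is nondecreasing and bounded, so from some [j0] on it is
    within [e / 2] of its supremum. From there, [g] drops from [x 0] by the distance from [x 0], up
    to [e / 2]. *)
Lemma almost_geodesic_limit (eps : R) :
  (forall l, (1 <= l)%N -> \sum_(1 <= i < l.+1) d (x i.-1) (x i) <= d (x 0%N) (x l) + eps) ->
  forall e : R, 0 < e -> \forall n \near \oo, d b (x n) + g (x n) <= e.
Proof.
move=> ag e e0.
pose S l := \sum_(1 <= i < l.+1) d (x i.-1) (x i).
pose E l := S l - d (x 0%N) (x l).
have SS l : S l.+1 = S l + d (x l) (x l.+1) by rewrite /S big_nat_recr.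
have Emon j l : (j <= l)%N -> E j <= E l.
  move=> /subnK <-; elim: (l - j)%N => [//|m IH]; apply: le_trans IH _.
  rewrite /E addSn SS; have := d_tri (Px 0%N) (Px (m + j)) (Px (m + j).+1); lra.
have Sge j l : (j <= l)%N -> S j + d (x j) (x l) <= S l.
  move=> /subnK <-; elim: (l - j)%N => [|m IH]; first by rewrite add0n d_refl addr0.
  rewrite addSn SS; have := d_tri (Px j) (Px (m + j)) (Px (m + j).+1); lra.
have hE : has_sup (range E).
  split; first by exists (E 0%N), 0%N.
  exists eps => _ [l _ <-]; apply: le_trans (Emon l l.+1 _) _ => //.
  by have := ag l.+1 isT; rewrite -/(S _) /E; lra.
have e2 : 0 < e / 2 by rewrite divr_gt0.
have [_ [j0 _ <-] hj0] := sup_adherent e2 hE.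
have hg j : (j0 <= j)%N -> d (x 0%N) (x j) - e / 2 <= g (x 0%N) - g (x j).
  move=> jj; apply: cvgr_to_ge (cvgB (xg (Px 0%N)) (xg (Px j))) _.
  exists j => // l /= jl; rewrite !fctE; have := Sge _ _ jl; have := Emon _ _ jj.
  have : E l <= sup (range E) by apply: sup_upper_bound => //; exists l.
  rewrite /E in hj0 *; lra.
have /cvgrPdist_lt/(_ _ e2) := xg (Px 0%N).
have : \forall n \near \oo, (j0 <= n)%N by exact: nbhs_infty_ge.
apply: filterS2 => n /hg h1; rewrite ltr_norml => /andP[]; lra.
Qed.

End DistanceSequences.

(** * The sequence built from affine minorants *)

Section StableBusemann.
Variables (R : realType) (N : nat).
Local Notation V := 'rV[R]_N.
Implicit Types (y z u v w : V).
Variables (D : set V) (b p : V) (x : nat -> V) (U : set_system nat) (g : V -> R).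
Hypotheses (hD : bounded_convex_domain D) (Db : D b) (Dx : forall n, D (x n)).
Context {UU : UltraFilter U}.
Hypothesis xp : x @ U --> p.
Hypothesis xg : forall y, D y ->
  (fun n => hilbert_dist D y (x n) - hilbert_dist D b (x n)) @ U --> g y.

Local Notation K := (polar D).
Local Notation A := (epilimit D b x U).
Local Notation G := (funk_part D b p g).

Lemma limit_base : g b = 0.
Proof.
have h := xg Db; have h0 : (fun n => hilbert_dist D b (x n) - hilbert_dist D b (x n)) @ U --> (0 : R).
  by under eq_fun do rewrite subrr; exact: cvg_cst.
exact: norm_cvg_unique h h0.
Qed.

Lemma funk_part_base : G b = 1.
Proof. by rewrite /funk_part limit_base expR0 mul1r divff // gt_eqF // (funk_gt0 hD). Qed.

Lemma limit_closure : closure D p.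
Proof.
apply/closure_normP => e e0; have /cvgrPdist_lt/(_ _ e0) h := xp.
by have [n pn] := filter_ex h; exists (x n).
Qed.

Lemma ln_funk_part y : D y -> ln (G y) = g y + ln (funk D p b) - ln (funk D p y).
Proof.
move=> Dy; rewrite /funk_part lnM ?posrE ?mulr_gt0 ?expR_gt0 ?invr_gt0 ?(funk_gt0 hD) //.
by rewrite lnM ?posrE ?expR_gt0 ?(funk_gt0 hD) // expRK lnV // posrE (funk_gt0 hD).
Qed.

(** As [p] is a boundary point, [ell p] vanishes somewhere on [K], so [funk D b (x n)] tends to
    infinity and the epi-limit is infinite wherever [ell p > 0]. *)
Lemma epilimit_ell_eq0 u (s : R) : ~ D p -> A (u, s) -> ell p u = 0.
Proof.
move=> nDp Aus; have [Ku h] := Aus.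
have clp := limit_closure.
apply/eqP; rewrite eq_le (ell_ge0_closure hD clp Ku) andbT leNgt; apply/negP => lu.
have [u0 Ku0 lu0] : exists2 u0, K u0 & ell p u0 = 0.
  apply: contrapT => nu0; apply: nDp; apply: (bipolar hD) => u0 Ku0.
  rewrite lt_def (ell_ge0_closure hD clp Ku0) andbT.
  by apply/eqP => l0; apply: nu0; exists u0.
have s0 : 0 < s by apply: lt_le_trans (epilimit_ge hD Dx Aus); exact: (ell_gt0 hD).
have lb0 := ell_gt0 hD Db Ku0.
have [k k0 hk] := ell_lip hD.
have [c c0 hc] := ell_lipr p.
pose e := Num.min 1 (ell p u / c / 4).
have e0 : 0 < e by rewrite lt_min ltr01 !divr_gt0.
have e1 : e <= 1 by rewrite ge_min lexx.
have ec : e * c <= ell p u / 4.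
  by rewrite -ler_pdivlMr // mulrAC ge_min lexx orbT.
(* [q] bounds [|ell p - ell (x n)|] on [K]; the second argument of the minimum makes
   [funk D b (x n)] too large for the height [s + 1]. *)
pose q := Num.min (ell p u / 4) (ell p u * ell b u0 / (s + 1) / 4).
have q0 : 0 < q by rewrite lt_min !divr_gt0 ?mulr_gt0 // addr_gt0.
have /cvgrPdist_lt/(_ _ (divr_gt0 q0 k0)) hx := xp.
have [n [hn [v Kv [uv l]]]] := filter_ex (filterI hx (h _ e0)).
have hq w : K w -> `|ell p w - ell (x n) w| <= q.
  move=> Kw; apply: le_trans (hk _ _ _ Kw) _.
  by rewrite mulrC -ler_pdivlMr // ltW.
have q1 : q <= ell p u / 4 by rewrite ge_min lexx.
have q2 : q * (s + 1) <= ell p u * ell b u0 / 4.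
  by rewrite -ler_pdivlMr ?addr_gt0 // mulrAC ge_min lexx orbT.
have a1 : ell b u0 <= funk D b (x n) * q.
  apply: le_trans (funk_ell hD b (Dx n) Ku0) _.
  rewrite ler_pM2l ?(funk_gt0 hD) //.
  have := hq _ Ku0; rewrite lu0 ler_norml => /andP[]; lra.
have a2 : ell p u / 2 <= ell (x n) v.
  have := hq _ Kv; have := hc u v; rewrite !ler_norml => /andP[_ h1] /andP[_ h2].
  have : c * `|u - v| <= c * e by rewrite ler_wpM2l // ltW.
  lra.
have a3 : funk D b (x n) * ell (x n) v < s + 1 by apply: lt_le_trans l _; rewrite lerD2l.
have M0 := funk_gt0 hD b (Dx n).
move: (funk D b (x n)) (ell (x n) v) (ell b u0) (ell p u) M0 a1 a2 a3 q2 lb0 lu => m a lb l0.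
move=> M0 a1 a2 a3 q2 lb0 lu.
have h1 : m * (l0 / 2) <= m * a by rewrite ler_wpM2l // ltW.
have h2 : m * (l0 / 2) * q <= (s + 1) * q by rewrite ler_wpM2r ?ltW //; lra.
have h3 : lb * (l0 / 2) <= m * q * (l0 / 2) by rewrite ler_wpM2r //; lra.
have h4 : 0 < lb * l0 by rewrite mulr_gt0.
lra.
Qed.

Lemma stable_busemann_seq : stable_convex (polar D) -> ~ D p ->
  exists z : nat -> V, [/\ forall n, D (z n), seq_converges_to D b z g &
    forall e : R, 0 < e -> \forall n \near \oo, hilbert_dist D b (z n) + g (z n) <= e].
Proof.
move=> sK nDp; have clp := limit_closure.
have [h [hP hlim]] := epi_minorant_seq hD Db Dx xp xg sK.
(* The weight [(n + 1) / (n + 2)] on [p] forces [z n] to tend to [p]. It adds to the minorant [h n]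
   a multiple of [ell p], which vanishes on the domain of the epi-limit, so [c n * ell (z n)] is
   still a minorant. *)
pose z n : V := n.+2%:R^-1 *: ((h n).2 + n.+1%:R *: p).
pose c n : R := n.+2%:R * (h n).1.
have n2 n : n.+2%:R != 0 :> R by rewrite pnatr_eq0.
have c0 n : 0 < c n by have [h0 _ _] := hP n; rewrite mulr_gt0.
have cz n u : c n * ell (z n) u = (h n).1 * ell (h n).2 u + (h n).1 * n.+1%:R * ell p u.
  have -> : c n * ell (z n) u = (h n).1 * (n.+2%:R - dotp u (h n).2 - n.+1%:R * dotp u p).
    by rewrite /c /z /ell !dotpE; have := n2 n; move: (n.+2%:R) => m m0; field.
  by rewrite /ell -[n.+2%:R]natr1; ring.
have czge n u : K u -> (h n).1 * ell (h n).2 u <= c n * ell (z n) u.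
  move=> Ku; rewrite cz lerDl; have [h0 _ _] := hP n.
  by rewrite !mulr_ge0 ?(ell_ge0_closure hD) ?ltW.
have Dz n : D (z n).
  apply: (bipolar hD) => u Ku; rewrite -(pmulr_rgt0 _ (c0 n)).
  apply: lt_le_trans (czge n u Ku); have [h0 Dh _] := hP n.
  by rewrite mulr_gt0 // (ell_gt0 hD).
have czA n q : A q -> c n * ell (z n) q.1 < q.2.
  case: q => u s Aus; rewrite cz (epilimit_ell_eq0 nDp Aus) mulr0 addr0.
  by have [_ _] := hP n; apply.
have zp : z @ \oo --> p.
  have /bounded_normP[B hB] := domain_bounded hD.
  have B1 : 0 < `|p| + B + 1.
    by rewrite ltr_wpDl // addr_ge0 //; apply: le_trans (hB _ Db).
  apply/cvgrPdist_lt => e e0.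
  have [k hk] := ex_invr_lt (divr_gt0 e0 B1).
  exists k => // n /= kn.
  have -> : p - z n = n.+2%:R^-1 *: (p - (h n).2).
    apply/rowP => i; have := n2 n; rewrite !mxE -[n.+2%:R]natr1.
    by move: (n.+1%:R) => m m0; field.
  rewrite normrZ ger0_norm ?invr_ge0 //.
  have nk : n.+2%:R^-1 <= k.+1%:R^-1 :> R by rewrite lef_pV2 ?posrE // ler_nat !ltnS ltnW.
  have nz : 0 < n.+2%:R^-1 :> R by rewrite invr_gt0.
  have : `|p - (h n).2| <= `|p| + B.
    by apply: le_trans (ler_normB _ _) _; rewrite lerD2l; apply: hB; have [] := hP n.
  move: hk; rewrite ltr_pdivlMr //; move: (n.+2%:R^-1) (k.+1%:R^-1) nk nz => i j; nra.
have Mz y : D y -> (fun n => funk D (z n) y) @ \oo --> funk D p y.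
  by move=> Dy; exact: (cvg_funkl hD _ Dy zp).
have lnMz y : D y -> (fun n => ln (funk D (z n) y)) @ \oo --> ln (funk D p y).
  by move=> Dy; apply: continuous_cvg (Mz y Dy); apply: continuous_ln; exact: (funk_gt0 hD).
pose Q y n := funk D y (z n) / c n.
have Q0 y n : 0 < Q y n by rewrite divr_gt0 // (funk_gt0 hD).
(* The upper bound comes from the cofinality of [h], the lower one from an epigraph point at which
   [G y] is attained. *)
have QG y : D y -> Q y @ \oo --> G y.
  move=> Dy; apply/cvgrPdist_lt => e e0.
  have e2 : 0 < e / 2 by rewrite divr_gt0.
  apply: filterS (hlim y _ Dy e2) => n hn.
  have h1 : Q y n <= G y + e / 2.
    rewrite ler_pdivrMr //; apply: (funk_le hD) => // u Ku.
    apply: le_trans (hn u Ku) _; rewrite -mulrA ler_pM2l; first exact: czge.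
    by rewrite addr_gt0 // funk_part_gt0.
  have h2 : G y <= Q y n.
    have Gy := funk_part_gt0 p g hD Db Dy.
    have [u Au] := epilimit_attain hD Db Dx xp xg Dy; have Ku : K u by exact: Au.1.
    have /= := czA n _ Au; rewrite ltr_pdivlMr // => l.
    have ly := ell_gt0 hD Dy Ku.
    rewrite ler_pdivlMr // -(ler_pM2r (ell_gt0 hD (Dz n) Ku)).
    have := funk_ell hD y (Dz n) Ku; lra.
  by rewrite ltr_norml; apply/andP; split; lra.
have lnQ y : D y -> (fun n => ln (Q y n)) @ \oo --> ln (G y).
  by move=> Dy; apply: continuous_cvg (QG y Dy); apply: continuous_ln; exact: funk_part_gt0.
have dE y n : D y -> hilbert_dist D y (z n) = ln (Q y n) + ln (c n) + ln (funk D (z n) y).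
  move=> Dy; rewrite (hilbert_distE hD) // -(@lnM _ (Q y n)) ?posrE //.
  by rewrite /Q divfK // gt_eqF.
exists z; split=> // [y Dy|e e0].
  have -> : g y = ln (G y) + ln (funk D p y) - (ln (G b) + ln (funk D p b)).
    by rewrite funk_part_base ln1 ln_funk_part //; ring.
  have -> : (fun n => hilbert_dist D y (z n) - hilbert_dist D b (z n)) = (fun n =>
      ln (Q y n) + ln (funk D (z n) y) - (ln (Q b n) + ln (funk D (z n) b))).
    by apply/funext => n; rewrite !dE //; ring.
  by apply: cvgB; apply: cvgD; [exact: lnQ|exact: lnMz|exact: lnQ|exact: lnMz].
(* The defect is the sum of [ln (Q b n)], [ln (funk D (z n) b) - ln (funk D p b)] and
   [ln (funk D p (z n))], each eventually at most [e / 3], and of the nonpositive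
   [ln (c n) + ln (G (z n))]. *)
have e3 : 0 < e / 3 by rewrite divr_gt0.
have /cvgrPdist_lt/(_ _ e3) h1 := lnQ b Db; have /cvgrPdist_lt/(_ _ e3) h2 := lnMz b Db.
have [k hk] := ex_invr_lt e3.
have h3 : \forall n \near \oo, (k <= n)%N by exact: nbhs_infty_ge.
apply: filterS2 (filterI h1 h2) h3 => n [] /ltr_distlCDr l1 /ltr_distlCDr l2 kn.
rewrite funk_part_base ln1 in l1.
have Gz := ln_funk_part (Dz n); have Gz0 := funk_part_gt0 p g hD Db (Dz n).
have cG : ln (c n) + ln (G (z n)) <= 0.
  rewrite -lnM ?posrE //; apply: ln_le0.
  have [u Au] := epilimit_attain hD Db Dx xp xg (Dz n).
  have lu : 0 < ell (z n) u by exact: (ell_gt0 hD (Dz n) Au.1).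
  have := czA n _ Au; rewrite /= ltr_pdivlMr // => /ltW l.
  rewrite -(ler_pM2r lu) mul1r; apply: le_trans l; rewrite le_eqVlt; apply/orP; left.
  by apply/eqP; ring.
have Mp : ln (funk D p (z n)) <= n.+1%:R^-1.
  have : funk D p (z n) <= 1 + n.+1%:R^-1.
    apply: (funk_le hD) => // u Ku; have [h0 Dh _] := hP n.
    rewrite -(ler_pM2l (c0 n)).
    have -> : c n * ((1 + n.+1%:R^-1) * ell (z n) u) = (1 + n.+1%:R^-1) * (c n * ell (z n) u) by ring.
    have -> : c n * ell p u = (1 + n.+1%:R^-1) * ((h n).1 * n.+1%:R * ell p u).
      have : n.+1%:R != 0 :> R by rewrite pnatr_eq0.
      by rewrite /c -[n.+2%:R]natr1; move: (n.+1%:R) => m m0; field.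
    have i0 : 0 < 1 + n.+1%:R^-1 :> R by rewrite addr_gt0 // invr_gt0.
    by rewrite ler_pM2l // cz lerDr mulr_ge0 ?ltW // (ell_gt0 hD).
  move=> Ml; apply: (@le_trans _ _ (ln (1 + n.+1%:R^-1))).
    by rewrite ler_ln ?posrE ?(funk_gt0 hD) // addr_gt0 // invr_gt0.
  by apply: le_ln1Dx; apply: (@lt_trans _ _ 0); rewrite ?ltrN10 // invr_gt0.
have nk : n.+1%:R^-1 <= k.+1%:R^-1 :> R by rewrite lef_pV2 ?posrE // ler_nat ltnS.
rewrite dE //.
move: (hilbert_dist D) Gz cG Mp nk l1 l2 hk => _.
move: (ln (c n)) (ln (G (z n))) (ln (funk D p (z n))) (n.+1%:R^-1) (k.+1%:R^-1) (ln (Q b n)).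
move: (ln (funk D (z n) b)) (ln (funk D p b)) (g (z n)).
move=> t1 t2 t3 t4 t5 t6 t7 t8 t9; lra.
Qed.

End StableBusemann.

Lemma leq_increasing (f : nat -> nat) : (forall k, (f k < f k.+1)%N) -> forall k, (k <= f k)%N.
Proof. by move=> hf; elim=> [//|k IH]; exact: leq_ltn_trans IH (hf k). Qed.

(** * Closed families of extreme sets and stability *)

Section PainleveKuratowski.
Variables (R : realType) (N : nat).
Local Notation V := 'rV[R]_N.
Implicit Types (p q u v w x y : V) (C K : set V).

Lemma nbhs_norm_lt x (e : R) : 0 < e -> nbhs x [set y | `|x - y| < e].
Proof. by move=> e0; have := nbhsx_ballx x e e0; rewrite -ball_normE. Qed.

Lemma cvg_invr_lt (x_ : nat -> V) x :
  (forall n, `|x - x_ n| < n.+1%:R^-1) -> x_ @ \oo --> x.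
Proof.
move=> h; apply/cvgrPdist_lt => e e0; have [k hk] := ex_invr_lt e0.
exists k => // n /= kn; apply: lt_trans (h n) _; apply: le_lt_trans hk.
by rewrite lef_pV2 ?posrE // ler_nat ltnS.
Qed.

(** [C] is the limit along [U]. Compactness makes the approximation uniform in both directions, and
    a subsequence realizing the bounds [1 / (j + 1)] then replaces the ultrafilter. *)
Lemma PK_compact (U : set_system nat) (UU : UltraFilter U) (K : set V) (C_ : nat -> set V) :
  \oo `<=` U -> compact K -> (forall n, C_ n `<=` K) ->
  exists (f : nat -> nat) (C : set V), [/\ forall k, (f k < f k.+1)%N, closed C &
    PK_converges (C_ \o f) C].
Proof.
move=> oU cK CK; pose C : set V := [set x | forall e : R, 0 < e ->
  \forall n \near U, exists2 y, C_ n y & `|x - y| < e].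
have clC : closed C.
  move=> x /closure_normP cx e e0; have e2 : 0 < e / 2 by rewrite divr_gt0.
  have [y Cy xy] := cx _ e2; apply: filterS (Cy _ e2) => n [z Cz yz].
  exists z => //; have -> : x - z = (x - y) + (y - z) by rewrite addrA subrK.
  by apply: le_lt_trans (ler_normD _ _) _; lra.
have sCK : C `<=` K.
  move=> x Cx; have clK : closed K by exact: compact_closed.
  apply: clK; apply/closure_normP => e e0.
  by have [n [y /CK Ky xy]] := filter_ex (Cx _ e0); exists y.
have cC : compact C by exact: subclosed_compact cK sCK.
have h1 (d : R) : 0 < d -> \forall n \near U, forall x, C x -> exists2 y, C_ n y & `|x - y| < d.
  move=> d0; have d2 : 0 < d / 2 by rewrite divr_gt0.
  apply: ((compact_near_coveringP C).1 cC nat U (fun n x => exists2 y, C_ n y & `|x - y| < d)).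
  move=> x Cx; exists ([set x' | `|x - x'| < d / 2], [set n | exists2 y, C_ n y & `|x - y| < d / 2]).
    by split; [exact: nbhs_norm_lt|exact: Cx].
  move=> [x' n] [/= xx' [y Cy xy]]; exists y => //.
  have -> : x' - y = - (x - x') + (x - y) by rewrite opprB addrA subrK.
  by apply: le_lt_trans (ler_normD _ _) _; rewrite normrN; lra.
have h2 (d : R) : 0 < d -> \forall n \near U, forall y, C_ n y -> exists2 x, C x & `|x - y| < d.
  move=> d0.
  have := ((compact_near_coveringP K).1 cK nat U (fun n y => C_ n y -> exists2 x, C x & `|x - y| < d)).
  move=> h; apply: filterS (h _ _) => [n hn y Cy|y Ky]; first exact: hn (CK _ _ Cy) Cy.
  have [Cy|nCy] := pselect (C y).
    exists ([set y' | `|y - y'| < d], setT); last by move=> [y' n] [/= yy' _ _]; exists y.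
    by split; [exact: nbhs_norm_lt|exact: filterT].
  have [e e0 he] : exists2 e : R, 0 < e & U [set n | ~ exists2 z, C_ n z & `|y - z| < e].
    apply: contrapT => ne; apply: nCy => e e0.
    have [//|UnP] := in_ultra_setVsetC [set n | exists2 z, C_ n z & `|y - z| < e] UU.
    by case: ne; exists e.
  exists ([set y' | `|y - y'| < e], [set n | ~ exists2 z, C_ n z & `|y - z| < e]).
    by split=> //; exact: nbhs_norm_lt.
  by move=> [y' n] [/= yy' nz Cy']; case: nz; exists y'.
have i0 j : 0 < j.+1%:R^-1 :> R by rewrite invr_gt0.
have [f [finc hf]] := ultra_subseq _ oU (fun j => filterI (h1 _ (i0 j)) (h2 _ (i0 j))).
exists f, C; split=> //; split=> [x Cx|nk x_ x nkinc hx xx].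
  have /choice[y hy] : forall k, exists y, C_ (f k) y /\ `|x - y| < k.+1%:R^-1.
    by move=> k; have [/(_ x Cx)[y ? ?] _] := hf k; exists y.
  exists y; split; first by apply: nearW => k; have [] := hy k.
  by apply: cvg_invr_lt => k; have [] := hy k.
apply: clC; apply/closure_normP => e e0; have e2 : 0 < e / 2 by rewrite divr_gt0.
have /cvgrPdist_lt/(_ _ e2) h3 := xx; have [k hk] := ex_invr_lt e2.
have h4 : \forall n \near \oo, (k <= n)%N by exact: nbhs_infty_ge.
have [n [/= h5 /= kn]] := filter_ex (filterI h3 h4).
have [_ /(_ _ (hx n))[z Cz /= zx]] := hf (nk n); exists z => //.
have : (nk n).+1%:R^-1 <= k.+1%:R^-1 :> R.
  by rewrite lef_pV2 ?posrE // ler_nat ltnS (leq_trans kn) // leq_increasing.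
have -> : x - z = (x - x_ n) + - (z - x_ n) by rewrite opprB addrA subrK.
move=> /(lt_le_trans zx) /lt_trans/(_ hk) h6.
by apply: le_lt_trans (ler_normD _ _) _; rewrite normrN; lra.
Qed.

(** * Faces of a convex set and their dimension *)

Definition face_dir K w : set V :=
  [set v | exists2 e : R, 0 < e & K (w + e *: v) /\ K (w - e *: v)].

(** For convex [K] and [w] in [K], this is the smallest extreme set containing [w]. *)
Definition face K w : set V := [set u | K u /\ face_dir K w (u - w)].

Section Face.
Variable K : set V.
Hypothesis cvK : convex K.

Lemma convex_shrink w v (e e' : R) : K w -> K (w + e *: v) -> 0 < e' -> e' <= e -> K (w + e' *: v).
Proof.
move=> Kw Kv e'0 e'e; have e0 : 0 < e by exact: lt_le_trans e'e.
have -> : w + e' *: v = (1 - e' / e) *: w + (e' / e) *: (w + e *: v).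
  by apply/rowP => i; rewrite !mxE; field; rewrite gt_eqF.
apply: cvK => //; first by rewrite divr_ge0 // ltW.
by rewrite ler_pdivrMr // mul1r.
Qed.

Lemma face_dirZ w v (a : R) : K w -> face_dir K w v -> face_dir K w (a *: v).
Proof.
move=> Kw [e e0 [h1 h2]]; have [->|a0] := eqVneq a 0.
  by exists 1; rewrite ?ltr01 // scale0r scaler0 addr0 subr0.
exists (e / `|a|); first by rewrite divr_gt0 // normr_gt0.
have [ap|an|aE] := ltgtP a 0; last by rewrite aE eqxx in a0.
  rewrite ltr0_norm // scalerA.
  have -> : e / - a * a = - e by field.
  by rewrite scaleNr opprK.
by rewrite gtr0_norm // scalerA divfK.
Qed.

Lemma face_dirD w v v' : K w -> face_dir K w v -> face_dir K w v' -> face_dir K w (v + v').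
Proof.
move=> Kw [e e0 [h1 h2]] [e' e'0 [h1' h2']].
pose d := Num.min e e'; have d0 : 0 < d by rewrite lt_min e0.
have [de de'] : d <= e /\ d <= e' by rewrite !ge_min !lexx orbT.
have half u u' : K (w + d *: u) -> K (w + d *: u') -> K (w + (d / 2) *: (u + u')).
  move=> Ku Ku'; have -> : w + (d / 2) *: (u + u') =
      (1 - 2^-1) *: (w + d *: u) + 2^-1 *: (w + d *: u').
    by apply/rowP => i; rewrite !mxE; field.
  by apply: cvK => //; lra.
exists (d / 2); first by rewrite divr_gt0.
split; first by apply: half; apply: convex_shrink d0 _; eassumption.
rewrite -scalerN opprD; apply: half.
  by apply: convex_shrink d0 de => //; rewrite scalerN.
by apply: convex_shrink d0 de' => //; rewrite scalerN.
Qed.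

Lemma face_dir_mem w u (e : R) : K w -> K u -> 0 < e -> K (w + e *: (w - u)) -> face K w u.
Proof.
move=> Kw Ku e0 h; split=> //; pose d := Num.min e 1.
have d0 : 0 < d by rewrite lt_min e0 ltr01.
have [de d1] : d <= e /\ d <= 1 by rewrite !ge_min !lexx orbT.
exists d => //; split.
  by apply: (@convex_shrink _ _ 1) => //; rewrite scale1r addrC subrK.
by rewrite -scalerN opprB; apply: convex_shrink d0 de.
Qed.

Lemma face_self w : K w -> face K w w.
Proof.
by move=> Kw; split=> //; exists 1; rewrite ?ltr01 // subrr scaler0 addr0 subr0.
Qed.

Lemma face_extreme w : K w -> extreme_set K (face K w).
Proof.
move=> Kw; split; first by move=> u [].
split.
  move=> u v t [Ku Lu] [Kv Lv] t0 t1; split; first exact: cvK.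
  have -> : (1 - t) *: u + t *: v - w = (1 - t) *: (u - w) + t *: (v - w).
    by apply/rowP => i; rewrite !mxE; ring.
  by apply: face_dirD => //; exact: face_dirZ.
have half p q (t : R) : K p -> K q -> 0 < t -> t < 1 -> face K w ((1 - t) *: p + t *: q) -> face K w p.
  move=> Kp Kq t0 t1 [Kf [e e0 [_ h]]].
  (* The segment from [p] is prolonged beyond [w] by combining [q] with a point of [K] that lies
     beyond [w] as seen from [(1 - t) p + t q]. *)
  have et : 0 < 1 + e * t by rewrite addr_gt0 // mulr_gt0.
  apply: (@face_dir_mem _ _ (e * (1 - t) / (1 + e * t))) => //.
    by rewrite divr_gt0 // mulr_gt0 // subr_gt0.
  set w' := w - _ in h.
  have -> : w + (e * (1 - t) / (1 + e * t)) *: (w - p) =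
      (1 - e * t / (1 + e * t)) *: w' + (e * t / (1 + e * t)) *: q.
    by apply/rowP => i; rewrite /w' !mxE; field; rewrite gt_eqF.
  apply: cvK => //; first by rewrite divr_ge0 // ltW // mulr_gt0.
  by rewrite ler_pdivrMr // mul1r lerDr.
move=> p q t Kp Kq t0 t1 h; split; first exact: half h.
apply: (@half q p (1 - t)) => //; [lra|lra|].
by rewrite subKr addrC.
Qed.

Lemma row_free_extend k v (B : 'M[R]_(k, N)) :
  row_free B -> ~~ (v <= B)%MS -> row_free (col_mx v B).
Proof.
move=> fB nv; apply: inj_row_free => y.
rewrite -[y]hsubmxK mul_row_col; set a := lsubmx y; set c := rsubmx y => h.
have [s aE] : exists s, a = s%:M by exists (a ord0 ord0); exact: mx11_scalar.
move: h; rewrite aE mul_scalar_mx => h.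
have s0 : s = 0.
  apply/eqP/negPn/negP => s0; case/negP: nv.
  have -> : v = (- s^-1 *: c) *m B.
    move/eqP: h; rewrite addr_eq0 => /eqP h.
    by rewrite -scalemxAl scaleNr -scalerN -h scalerA mulVf // scale1r.
  exact: submxMl.
move: h; rewrite s0 scale0r add0r => /eqP.
by rewrite mulmx_free_eq0 // => /eqP ->; rewrite raddf0 row_mx0.
Qed.

(** Face directions form a linear space, so a free family of maximal size spans it. *)
Lemma face_dir_basis w : K w -> exists k (B : 'M[R]_(k, N)),
  forall v, face_dir K w v <-> (v <= B)%MS.
Proof.
move=> Kw; pose P k := `[< exists B : 'M[R]_(k, N), row_free B /\ forall i, face_dir K w (row i B) >].
have P0 : exists k, P k.
  exists 0%N; apply/asboolP; exists 0; split; last by case.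
  by rewrite /row_free mxrank0.
have PN k : P k -> (k <= N)%N.
  by move=> /asboolP[B [/eqP fB _]]; rewrite -fB rank_leq_col.
case: (ex_maxnP P0 PN) => k /asboolP[B [fB LB]] maxk.
exists k, B => v; split=> [Lv|/submxP[D ->]].
  apply/negPn/negP => nv; suff : P k.+1 by move=> /maxk; rewrite ltnn.
  apply/asboolP; exists (col_mx v B); split; first exact: row_free_extend.
  move=> i; case: (@split_ordP 1 k i) => j ->.
    by rewrite (@rowKu _ 1 k) row_id.
  by rewrite (@rowKd _ 1 k).
rewrite mulmx_sum_row; apply: big_ind.
- by exists 1; rewrite ?ltr01 // scaler0 addr0 subr0.
- by move=> *; exact: face_dirD.
- by move=> i _; exact: face_dirZ.
Qed.

(** The columns of the cokernel of a spanning matrix give the linear equations that cut the face out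
    of [K]. *)
Lemma face_closed w : closed K -> K w -> closed (face K w).
Proof.
move=> clK Kw; have [k [B hB]] := face_dir_basis Kw.
pose c j := (col j (cokermx B))^T.
have -> : face K w = K `&` \bigcap_j [set u | dotp u (c j) = dotp w (c j)].
  have hE u : (u - w <= B)%MS <-> forall j, dotp u (c j) = dotp w (c j).
    have cE j : ((u - w) *m cokermx B) ord0 j = dotp u (c j) - dotp w (c j).
      rewrite -[- dotp w _]dotpNl -dotpDl mxE.
      by apply: eq_bigr => i _; rewrite !mxE.
    rewrite submxE; split=> [/eqP h j|h].
      by apply/eqP; rewrite -subr_eq0 -cE h mxE.
    by apply/eqP/rowP => j; rewrite cE h subrr mxE.
  apply/seteqP; split=> u [Ku h]; split=> //.
    by move=> j _; move/hB/hE: h => /(_ j).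
  by apply/hB/hE => j; exact: h.
apply: closedI => //; apply: closed_bigI => j _.
apply: (closed_comp (f := fun u => dotp u (c j)) (D := [set dotp w (c j)])).
  by move=> u _; exact: continuous_dotp.
exact: closed_eq.
Qed.

(** An upper bound for the dimension of the face of [w], phrased through free families of
    directions. *)
Definition face_dim_lt w k := forall A : 'M[R]_(k, N),
  (forall i, face_dir K w (row i A)) -> ~~ row_free A.

(** At the last point of [K] on the ray, [v] is no longer a face direction, while every face
    direction there is one at [w]. Adding [v] to a free family at the end point thus gives a larger
    one at [w]. *)
Lemma boundary_point w v (e : R) : compact K -> K w -> v != 0 -> 0 < e ->
    K (w + e *: v) -> K (w - e *: v) ->
  exists2 s : R, 0 < s & K (w + s *: v) /\
    forall k, face_dim_lt w k.+1 -> face_dim_lt (w + s *: v) k.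
Proof.
move=> cK Kw v0 e0 h1 h2; pose S := [set s : R | 0 <= s /\ K (w + s *: v)].
have nv : 0 < `|v| by rewrite normr_gt0.
have hS : has_sup S.
  split; first by exists e; split=> //; exact: ltW.
  have /bounded_normP[B hB] := compact_bounded cK.
  exists ((B + `|w|) / `|v|) => s [s0 /hB h].
  rewrite ler_pdivlMr // -[s]ger0_norm // -normrZ.
  have -> : s *: v = (w + s *: v) - w by rewrite addrC addKr.
  by apply: le_trans (ler_normB _ _) _; rewrite lerD2r.
have ubS s : S s -> s <= sup S by move=> Ss; exact: sup_upper_bound.
have s0 : 0 < sup S by apply: lt_le_trans (ubS e _) => //; split=> //; exact: ltW.
have KS : K (w + sup S *: v).
  have clK : closed K by exact: compact_closed.
  apply: clK; apply/closure_normP => d d0.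
  have [s Ss ls] := sup_adherent (divr_gt0 d0 nv) hS; have Ks := Ss.2.
  exists (w + s *: v) => //.
  have -> : w + sup S *: v - (w + s *: v) = (sup S - s) *: v.
    by apply/rowP => i; rewrite !mxE; ring.
  have ss : 0 <= sup S - s by rewrite subr_ge0; exact: ubS.
  by rewrite normrZ ger0_norm // -ltr_pdivlMr //; lra.
exists (sup S) => //; split=> // k dk A hA; apply/negP => fA.
set s := sup S in s0 KS hA ubS.
(* The contraction with centre [w - e v] and ratio [e / (s + e)] maps [w + s v] to [w]. *)
have sub v' : face_dir K (w + s *: v) v' -> face_dir K w v'.
  move=> [d d0 [k1 k2]]; have es : 0 < s + e by rewrite addr_gt0.
  have th0 : 0 <= e / (s + e) by rewrite divr_ge0 // ltW.
  have th1 : e / (s + e) <= 1 by rewrite ler_pdivrMr // mul1r; lra.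
  exists (e / (s + e) * d); first by rewrite mulr_gt0 // divr_gt0.
  have -> : w + (e / (s + e) * d) *: v' =
      (1 - e / (s + e)) *: (w - e *: v) + (e / (s + e)) *: (w + s *: v + d *: v').
    by apply/rowP => i; rewrite !mxE; field; rewrite gt_eqF.
  have -> : w - (e / (s + e) * d) *: v' =
      (1 - e / (s + e)) *: (w - e *: v) + (e / (s + e)) *: (w + s *: v - d *: v').
    by apply/rowP => i; rewrite !mxE; field; rewrite gt_eqF.
  by split; exact: cvK.
have /negP : ~~ row_free (col_mx v A).
  apply: dk => i; case: (@split_ordP 1 k i) => j ->.
    by rewrite (@rowKu _ 1 k) row_id; exists e.
  by rewrite (@rowKd _ 1 k); exact: sub.
apply; apply: row_free_extend => //; apply/negP => /submxP[B vE].
have [d d0 [kd _]] : face_dir K (w + s *: v) v.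
  rewrite [X in face_dir _ _ X]vE mulmx_sum_row; apply: big_ind.
  - by exists 1; rewrite ?ltr01 // scaler0 addr0 subr0.
  - by move=> *; exact: face_dirD.
  - by move=> i _; exact: face_dirZ.
suff /ubS : S (s + d) by lra.
by split; [rewrite addr_ge0 // ltW|rewrite scalerDl addrA].
Qed.

End Face.

End PainleveKuratowski.

(** * Stability from closedness *)

Section StableOfClosed.
Variables (R : realType) (N : nat).
Local Notation V := 'rV[R]_N.
Implicit Types (p q u v w x y : V) (C K : set V).

Lemma normr_lerp_lt u p p' (s r : R) : 0 <= s -> s <= 1 -> `|u - p| < r -> `|u - p'| < r ->
  `|u - ((1 - s) *: p + s *: p')| < r.
Proof.
move=> s0 s1 up up'; have {1}-> : u = (1 - s) *: u + s *: u.
  by rewrite -scalerDl subrK scale1r.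
exact: normr_comb_lt.
Qed.

Lemma stable_of_PK_closed K : compact K -> convex K ->
  PK_closed_family (extreme_set K) -> stable_convex K.
Proof.
move=> cK cvK hPK p q t Kp Kq t0 t1.
have clK : closed K by exact: compact_closed.
have [B B0 hB] : exists2 B : R, 0 < B & forall w, K w -> `|w| <= B.
  have /bounded_normP[B hB] := compact_bounded cK.
  exists (`|B| + 1); first by rewrite ltr_wpDl.
  by move=> w /hB h; apply: le_trans h _; rewrite ler_wpDr // ler_norm.
set m := (1 - t) *: p + t *: q.
pose dec (r : R) w := exists p' q', [/\ K p', K q', `|p - p'| < r, `|q - q'| < r &
  w = (1 - t) *: p' + t *: q'].
have dec_lerp r w w' (s : R) : dec r w -> dec r w' -> 0 <= s -> s <= 1 ->
    dec r ((1 - s) *: w + s *: w').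
  move=> [p1 [q1 [Kp1 Kq1 pp1 qq1 ->]]] [p2 [q2 [Kp2 Kq2 pp2 qq2 ->]]] s0 s1.
  exists ((1 - s) *: p1 + s *: p2), ((1 - s) *: q1 + s *: q2).
  split; [exact: cvK|exact: cvK|exact: normr_lerp_lt|exact: normr_lerp_lt|].
  by apply/rowP => i; rewrite !mxE; ring.
(* Induction on the dimension [k] of the face of [w].  A nearby point [m'] of that face is
   decomposed because the limit of the faces is extreme; [w] lies between [m'] and the boundary
   point [w'] of the ray from [m'] through [w], whose face has smaller dimension.  Either [w'] is
   near [m], and the induction hypothesis applies, or [w] is relatively close to [m']. *)
suff claim k : forall r : R, 0 < r -> exists2 rho : R, 0 < rho & forall w, K w ->
    `|m - w| < rho -> face_dim_lt K w k -> dec r w.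
  move=> r r0; have [rho rho0 h] := claim N.+1 r r0; exists rho => // w Kw mw.
  apply: h => // A _; apply/negP => /eqP rA.
  by have := rank_leq_col A; rewrite rA ltnn.
elim: k => [|k IH] r r0.
  exists 1 => // w _ _ h; have /negP : ~~ row_free (0 : 'M[R]_(0, N)) by apply: h; case.
  by rewrite /row_free mxrank0.
apply: contrapT => nh.
have /choice[w_ hw_] : forall n : nat, exists w, [/\ K w, `|m - w| < n.+1%:R^-1,
    face_dim_lt K w k.+1 & ~ dec r w].
  move=> n; apply: contrapT => nw; apply: nh; exists n.+1%:R^-1; first by rewrite invr_gt0.
  by move=> w Kw mw dw; apply: contrapT => nd; apply: nw; exists w.
have Kw n : K (w_ n) by have [] := hw_ n.
have [U [UU oU]] := ultra_nat.
have FK n : face K (w_ n) `<=` K by move=> u [].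
have [f [C [finc clC CC]]] := PK_compact UU oU cK FK.
(* Closedness of the family enters here: the limit [C] of the faces contains [m], hence [p] and [q],
   which are therefore approached by points of the faces. *)
have [CK [cvC exC]] : extreme_set K C.
  apply: (hPK ((fun n => face K (w_ n)) \o f) C) => // n /=.
    exact: face_closed.
  exact: face_extreme.
have Cm : C m.
  apply: (CC.2 id (w_ \o f)) => // [n|].
    exact: face_self.
  apply: cvg_invr_lt => n /=; have [_ h _ _] := hw_ (f n); apply: lt_le_trans h _.
  by rewrite lef_pV2 ?posrE // ler_nat ltnS leq_increasing.
have [Cp Cq] := exC p q t Kp Kq t0 t1 Cm.
have [p_ [Fp pp]] := CC.1 p Cp; have [q_ [Fq qq]] := CC.1 q Cq.
have [rho rho0 hrho] := IH r r0.
(* In the far case [th <= 4 e / rho], and moving by the fraction [th] inside [K] costs at most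
   [2 B th]; the total error is then at most [e * c], which is below [r]. *)
pose c := 1 + 8 * B / rho.
have c1 : 1 <= c by rewrite lerDl divr_ge0 ?mulr_ge0 // ltW.
pose e := Num.min (rho / 4) (r / c / 2).
have c0 : 0 < c by apply: lt_le_trans c1.
have e0 : 0 < e by rewrite lt_min !divr_gt0.
have erho : e <= rho / 4 by rewrite ge_min lexx.
have er : e * c <= r / 2 by rewrite -ler_pdivlMr // mulrAC ge_min lexx orbT.
have er' : e <= r / 2 by nra.
have [k0 hk0] := ex_invr_lt e0.
move/cvgrPdist_lt/(_ _ e0): pp => pp; move/cvgrPdist_lt/(_ _ e0): qq => qq.
have h4 : \forall n \near \oo, (k0 <= n)%N by exact: nbhs_infty_ge.
have [n [[[Fp' Fq'] [/= pp' /= qq']] /= kn]] :=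
  filter_ex (filterI (filterI (filterI Fp Fq) (filterI pp qq)) h4).
have [_ mw dw] := hw_ (f n); apply.
have {}mw : `|m - w_ (f n)| < e.
  apply: lt_trans mw _; apply: le_lt_trans hk0.
  by rewrite lef_pV2 ?posrE // ler_nat ltnS (leq_trans kn) // leq_increasing.
move: Fp' Fq' pp' qq' mw dw; rewrite /= ; move: (w_ (f n)) (Kw (f n)) (p_ n) (q_ n).
move=> w {}Kw p' q' Fp' Fq' pp' qq' mw dw {Fp Fq pp qq kn h4 hk0 CC}.
have Kp' := Fp'.1; have Kq' := Fq'.1.
pose m' := (1 - t) *: p' + t *: q'.
have Fm : face K w m' by apply: (face_extreme cvK Kw).2.1 => //; exact: ltW.
have dm : dec r m'.
  by exists p', q'; split=> //; [apply: lt_trans pp' _|apply: lt_trans qq' _]; nra.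
have mm' : `|m - m'| < e by apply: normr_comb_lt; rewrite ?ltW.
have [->//|wm] := eqVneq w m'.
have v0 : w - m' != 0 by rewrite subr_eq0.
have [_ [d d0 [hd1 hd2]]] := Fm.
have hd1' : K (w + d *: (w - m')) by rewrite -(opprB m') scalerN.
have hd2' : K (w - d *: (w - m')) by rewrite -(opprB m') scalerN opprK.
have [s s0 [Ks ds]] := boundary_point cvK cK Kw v0 d0 hd1' hd2'.
set w' := w + s *: (w - m') in Ks ds.
have sp : 0 < 1 + s by rewrite addr_gt0.
pose th := (1 + s)^-1.
have th0 : 0 <= th by rewrite invr_ge0 ltW.
have th1 : th <= 1 by rewrite invf_le1 // lerDl ltW.
have wE : w = (1 - th) *: m' + th *: w'.
  by apply/rowP => i; rewrite /w' /th !mxE; field; rewrite gt_eqF.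
have [near|far] := ltP `|m - w'| rho.
  by rewrite wE; apply: dec_lerp => //; apply: hrho => //; exact: ds.
have thE : th * `|w' - m'| = `|w - m'|.
  have -> : w' - m' = (1 + s) *: (w - m').
    by apply/rowP => i; rewrite /w' !mxE; ring.
  by rewrite normrZ gtr0_norm // mulrA mulVf ?gt_eqF // mul1r.
have l1 : `|w - m'| < 2 * e.
  have -> : w - m' = - (m - w) + (m - m') by rewrite opprB addrA subrK.
  by apply: le_lt_trans (ler_normD _ _) _; rewrite normrN; lra.
have l2 : rho - e <= `|w' - m'|.
  have : `|m - w'| <= `|m - m'| + `|w' - m'|.
    have -> : m - w' = (m - m') + - (w' - m') by rewrite opprB addrA subrK.
    by apply: le_trans (ler_normD _ _) _; rewrite normrN.
  lra.
have l3 : th * rho <= 4 * e by nra.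
have near' u u' : K u -> K u' -> `|u - u'| < e -> `|u - ((1 - th) *: u' + th *: w')| < r.
  move=> Ku Ku' uu.
  have -> : u - ((1 - th) *: u' + th *: w') = (u - u') + th *: (u' - w').
    by apply/rowP => i; rewrite !mxE; ring.
  apply: le_lt_trans (ler_normD _ _) _; rewrite normrZ ger0_norm //.
  have : `|u' - w'| <= 2 * B.
    apply: le_trans (ler_normB _ _) _; have := hB _ Ku'; have := hB _ Ks; lra.
  have l4 : th <= 4 * e / rho by rewrite ler_pdivlMr.
  have l5 : e * c = e + 4 * e / rho * (2 * B) by rewrite /c; field; rewrite gt_eqF.
  move=> l6; have : th * `|u' - w'| <= 4 * e / rho * (2 * B) by rewrite ler_pM.
  lra.
exists ((1 - th) *: p' + th *: w'), ((1 - th) *: q' + th *: w').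
split; [exact: cvK|exact: cvK|exact: near'|exact: near'|].
by rewrite {1}wE /m'; apply/rowP => i; rewrite !mxE; ring.
Qed.

End StableOfClosed.

(** * Busemann points have extreme domains *)

Section BusemannDomain.
Variables (R : realType) (N : nat).
Local Notation V := 'rV[R]_N.
Implicit Types (y u v w : V).
Variables (D : set V) (b p : V) (x : nat -> V) (U : set_system nat) (g : V -> R).
Hypotheses (hD : bounded_convex_domain D) (Db : D b) (Dx : forall n, D (x n)).
Context {UU : UltraFilter U}.
Hypothesis xp : x @ U --> p.
Hypothesis xg : forall y, D y ->
  (fun n => hilbert_dist D y (x n) - hilbert_dist D b (x n)) @ U --> g y.

Local Notation K := (polar D).
Local Notation A := (epilimit D b x U).
Local Notation G := (funk_part D b p g).

(** The defect at [z] is the logarithm of a product of two factors, [funk D b z * G z] and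
    [funk D z b * funk D p z / funk D p b]. Both are at least 1, so each is at most [1 + e]. *)
Lemma small_excess (e : R) z : 0 < e -> D z ->
    hilbert_dist D b z + g z <= ln (1 + e) ->
  (forall q, A q -> scaled_ell D b z q.1 <= (1 + e) * q.2) /\
  funk D z b * funk D p z <= (1 + e) * funk D p b.
Proof.
move=> e0 Dz; have Gz := funk_part_gt0 p g hD Db Dz.
have Mbz := funk_gt0 hD b Dz; have Mzb := funk_gt0 hD z Db.
have Mpz := funk_gt0 hD p Dz; have Mpb := funk_gt0 hD p Db.
have e1 : 0 < 1 + e by rewrite addr_gt0.
have h1 : 1 <= funk D b z * G z.
  have [u Au] := epilimit_attain hD Db Dx xp xg Db; have Ku : K u by exact: Au.1.
  have lb := ell_gt0 hD Db Ku.
  rewrite -(ler_pM2r lb) mul1r; apply: le_trans (scaled_ell_ge b hD Dz Ku) _.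
  rewrite -mulrA ler_pM2l //; apply: le_trans (epilimit_le hD Db Dx xp xg Dz Au) _.
  by rewrite (funk_part_base p hD Db xg) divr1.
have h2 : 1 <= funk D z b * funk D p z / funk D p b.
  by rewrite ler_pdivlMr // mul1r mulrC; exact: funk_triangle.
rewrite (hilbert_distE hD) //; have := ln_funk_part p g hD Db Dz.
move=> lnG sm.
have sum : ln (funk D b z * G z) + ln (funk D z b * funk D p z / funk D p b) <= ln (1 + e).
  rewrite lnM ?posrE // lnM ?posrE ?mulr_gt0 ?invr_gt0 // lnM ?posrE // lnV ?posrE // lnG.
  apply: le_trans sm; rewrite le_eqVlt; apply/orP; left; apply/eqP; ring.
have lnle (r : R) : 0 < r -> ln r <= ln (1 + e) -> r <= 1 + e by move=> r0; rewrite ler_ln ?posrE.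
have l1 : funk D b z * G z <= 1 + e.
  apply: lnle; first exact: mulr_gt0.
  by apply: le_trans sum; rewrite lerDl ln_ge0.
have l2 : funk D z b * funk D p z / funk D p b <= 1 + e.
  apply: lnle; first by rewrite !mulr_gt0 ?invr_gt0.
  by apply: le_trans sum; rewrite lerDr ln_ge0.
split; last by rewrite -ler_pdivrMr.
move=> [u s] Aus /=; have s0 : 0 < s.
  by apply: lt_le_trans (epilimit_ge hD Dx Aus); exact: (ell_gt0 hD Db Aus.1).
apply: le_trans (_ : funk D b z * G z * s <= _); last by rewrite ler_pM2r.
by rewrite /scaled_ell -mulrA ler_pM2l //; exact: (epilimit_le hD Db Dx xp xg Dz Aus).
Qed.

(* The functions [al n] converge to a finite value [a] at [q]; if [q] were outside the domain of the
   epi-limit, the segment [(q, a)]-[K x 0] would miss its epigraph, and a separating [c ell y] would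
   contradict the value of [g y]. *)
Lemma busemann_domain_extreme (z : nat -> V) u q (s t : R) :
  \oo `<=` U -> (forall n, D (z n)) -> seq_converges_to D b z g ->
  (forall e : R, 0 < e -> \forall n \near \oo, hilbert_dist D b (z n) + g (z n) <= e) ->
  K u -> K q -> 0 < t -> t < 1 -> A ((1 - t) *: u + t *: q, s) -> exists s', A (q, s').
Proof.
move=> oU Dz zg small Ku Kq t0 t1 Am.
have sm e : 0 < e -> \forall n \near U,
    (forall r, A r -> scaled_ell D b (z n) r.1 <= (1 + e) * r.2) /\
    funk D (z n) b * funk D p (z n) <= (1 + e) * funk D p b.
  move=> e0; have l0 : 0 < ln (1 + e) by rewrite ln_gt0 // ltrDl.
  by apply: filterS (oU _ (small _ l0)) => n; exact: small_excess.
have s0 : 0 < s by apply: lt_le_trans (epilimit_ge hD Dx Am); exact: (ell_gt0 hD Db Am.1).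
pose al n := scaled_ell D b (z n) q.
(* [t * al n] is at most the value at the combination, which small excess bounds by [2 s]. *)
have [a /= _ ala] : exists2 a : R, `[0, 2 * s / t]%classic a & al @ U --> a.
  apply: ultra_compact_cvg; first exact: segment_compact.
  apply: filterS (sm 1 ltr01) => n [/(_ _ Am) /= h _]; rewrite in_itv /=.
  have aq := scaled_ell_gt0 hD Db (Dz n) Kq; have au := scaled_ell_gt0 hD Db (Dz n) Ku.
  rewrite /al ltW //= ler_pdivlMr //; move: h; rewrite scaled_ell_comb -/(al n); nra.
have a0 : 0 < a.
  apply: lt_le_trans (ell_gt0 hD Db Kq) _; apply: cvgr_to_ge ala _.
  by apply: nearW => n; exact: scaled_ell_ge.
apply: contrapT => nA.
pose C2 : set (V * R) := [set (v, 0) | v in K].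
have C2c : compact C2.
  apply: continuous_compact (polar_compact hD); apply: continuous_subspaceT => v.
  have h1 : v' @[v' --> v] --> v by exact: cvg_id.
  exact: cvg_pair h1 (cvg_cst _).
have C2s : stable_comb C2.
  move=> _ _ tau [v Kv <-] [v' Kv' <-] tau0 tau1; exists ((1 - tau) *: v + tau *: v').
    exact: polar_convex.
  by congr pair; rewrite /= /GRing.scale /= !mulr0 addr0.
have C1s : stable_comb [set (q, a)].
  by move=> _ _ tau -> -> _ _ /=; rewrite -scalerDl subrK scale1r.
have [||v Kv||c [y [c0 Dy hC hA]]] := epilimit_sep hD Db Dx xp xg (C := join [set (q, a)] C2).
- exact: join_compact (@compact_set1 _ _) C2c.
- exact: join_stable_comb.
- exists 0 => //; exists 1, (q, a), (v, 0); split=> //; first by rewrite ler01 lexx.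
    by exists v.
  by rewrite subrr scale0r scale1r add0r.
- rewrite -subset0 => r [Ar [tau [_ [_ [/andP[tau0 tau1] -> [v Kv <-] rE]]]]].
  have [tauE|taun] := eqVneq tau 0.
    by apply: nA; exists a; move: Ar; rewrite rE tauE subr0 scale1r scale0r addr0.
  have taup : 0 < tau by rewrite lt_def taun.
  have lv := ell_gt0 hD Db Kv.
  (* A point of the epigraph on the join would force [tau * ell b v <= e * ((1 - tau) * a)]; this
     [e] makes the right side at most half of the left. *)
  pose e := tau * ell b v / (2 * a).
  have e0 : 0 < e by rewrite divr_gt0 // mulr_gt0.
  have ea : e * a = tau * ell b v / 2 by rewrite /e; field; rewrite gt_eqF.
  have : (1 - tau) * a + tau * ell b v <= (1 + e) * ((1 - tau) * a).
    have lim : (fun n => (1 - tau) * al n + tau * ell b v) @ U --> (1 - tau) * a + tau * ell b v.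
      by apply: cvgD; [apply: cvgM => //; exact: cvg_cst|exact: cvg_cst].
    apply: cvgr_to_le lim _; apply: filterS (sm _ e0) => n [/(_ _ Ar) + _].
    rewrite rE /= scaled_ell_comb /GRing.scale /= mulr0 addr0 => h.
    apply: le_trans h; rewrite lerD2l ler_pM2l //; exact: scaled_ell_ge.
  have : e * ((1 - tau) * a) <= e * a.
    by rewrite ler_pM2l // ler_piMl //; [exact: ltW|lra].
  have : 0 < tau * ell b v by rewrite mulr_gt0.
  lra.
have ac : a < c * ell y q.
  apply: (hC (q, a)); exists 0, (q, a), (q, 0); split=> //; first by rewrite ler01 lexx.
    by exists q.
  by rewrite subr0 scale1r scale0r addr0.
have Gy := funk_part_gt0 p g hD Db Dy.
have cG : c * G y < 1.
  have [v Av] := epilimit_attain hD Db Dx xp xg Dy; have := hA _ Av.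
  rewrite /= ltr_pdivlMr // mulrAC -{2}[ell y v]mul1r ltr_pM2r //.
  exact: (ell_gt0 hD Dy Av.1).
have lyq := ell_gt0 hD Dy Kq.
(* Since [c * G y < 1], this inequality contradicts [a < c * ell y q]. It is obtained by passing to
   the limit in [funk_ell] and [funk_triangle] at [z n]. *)
suff : ell y q <= G y * a.
  move=> h; have : c * ell y q <= c * (G y * a) by rewrite ler_pM2l.
  rewrite mulrA; have : c * G y * a < 1 * a by rewrite ltr_pM2r.
  lra.
apply/ler_addgt0Pr => d d0.
pose e := d / (G y * a).
have e0 : 0 < e by rewrite divr_gt0 // mulr_gt0.
have -> : G y * a + d = (1 + e) * (G y * a).
  by rewrite /e mulrDl mul1r divfK // gt_eqF // mulr_gt0.
have Mpb := funk_gt0 hD p Db; have Mpy := funk_gt0 hD p Dy.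
have lim : (fun n => expR (hilbert_dist D y (z n) - hilbert_dist D b (z n)) * al n) @ U -->
    expR (g y) * a.
  apply: cvgM => //; apply: continuous_cvg; first exact: continuous_expR.
  by move=> B /(zg y Dy) /oU.
rewrite -(ler_pM2r Mpy).
have -> : (1 + e) * (G y * a) * funk D p y = (1 + e) * funk D p b * (expR (g y) * a).
  by rewrite /funk_part; field; rewrite gt_eqF.
have e1 : 0 < (1 + e) * funk D p b by rewrite mulr_gt0 // addr_gt0.
rewrite -ler_pdivrMl //; apply: cvgr_to_ge lim _.
apply: filterS (sm _ e0) => n [_ h]; rewrite ler_pdivrMl //.
have Myz := funk_gt0 hD y (Dz n); have Mzy := funk_gt0 hD (z n) Dy.
have Mbz := funk_gt0 hD b (Dz n); have Mzb := funk_gt0 hD (z n) Db.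
have Mpz := funk_gt0 hD p (Dz n).
have -> : expR (hilbert_dist D y (z n) - hilbert_dist D b (z n)) * al n =
    funk D y (z n) * ell (z n) q * (funk D (z n) y / funk D (z n) b).
  rewrite !(hilbert_distE hD) // expRB !expRD !lnK ?posrE // /al /scaled_ell.
  by field; rewrite !gt_eqF.
have h1 := funk_ell hD y (Dz n) Kq.
have h2 := funk_triangle hD p (Dz n) Dy.
have lz := ell_gt0 hD (Dz n) Kq.
have h3 : funk D p y <= (1 + e) * funk D p b * (funk D (z n) y / funk D (z n) b).
  apply: le_trans h2 _; rewrite mulrA ler_pdivlMr //.
  have := ler_wpM2r (ltW Mzy) h; lra.
have h4 : ell y q * funk D p y <= funk D y (z n) * ell (z n) q *
    ((1 + e) * funk D p b * (funk D (z n) y / funk D (z n) b)).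
  by apply: ler_pM => //; exact: ltW.
by apply: le_trans h4 _; rewrite le_eqVlt; apply/orP; left; apply/eqP; ring.
Qed.

End BusemannDomain.

(** * Limits of extreme sets that are not extreme *)

Section NotClosed.
Variables (R : realType) (N : nat).
Local Notation V := 'rV[R]_N.
Implicit Types (p q u v w y : V) (C K : set V).

Lemma PK_limit (C_ : nat -> set V) C (x_ : nat -> V) v : PK_converges C_ C ->
  (\forall n \near \oo, C_ n (x_ n)) -> x_ @ \oo --> v -> C v.
Proof.
move=> [_ CC] [n0 _ h] xv; apply: (CC (fun k => k + n0)%N (fun k => x_ (k + n0)%N)) => // [k|].
  by apply: h => /=; exact: leq_addl.
apply/cvgrPdist_lt => e e0; have /cvgrPdist_lt/(_ _ e0)[n1 _ h1] := xv.
by exists n1 => // k /= kn; apply: h1 => /=; exact: leq_trans kn (leq_addr _ _).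
Qed.

(** The limit is still a convex subset of [K], so only the segment condition can fail; exchanging
    the endpoints moves the failure to [q]. *)
Lemma PK_extreme_fails K C (C_ : nat -> set V) : closed K ->
  (forall n, extreme_set K (C_ n)) -> PK_converges C_ C -> ~ extreme_set K C ->
  exists p q (t : R), [/\ K p, K q, 0 < t < 1, C ((1 - t) *: p + t *: q) & ~ C q].
Proof.
move=> clK exC CC nE; apply: contrapT => h; apply: nE; split.
  move=> v /CC.1[x_ [xC xv]]; apply: (closed_cvg K clK _ _ xv).
  by apply: filterS xC => n /(exC n).1.
split.
  move=> u v t /CC.1[x_ [xC xv]] /CC.1[y_ [yC yv]] t0 t1.
  apply: (PK_limit (x_ := fun n => (1 - t) *: x_ n + t *: y_ n) CC).
    by apply: filterS2 xC yC => n xn yn; exact: (exC n).2.1.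
  by apply: cvgD; apply: cvgZ => //; exact: cvg_cst.
have half p q (t : R) : K p -> K q -> 0 < t -> t < 1 -> C ((1 - t) *: p + t *: q) -> C q.
  move=> Kp Kq t0 t1 Cm; apply: contrapT => nCq; apply: h; exists p, q, t.
  by split=> //; rewrite t0.
move=> p q t Kp Kq t0 t1 Cm; split; last exact: half Cm.
apply: (@half q p (1 - t)) => //; [lra|lra|].
by rewrite subKr addrC.
Qed.

Lemma PK_avoid (C_ : nat -> set V) C q : PK_converges C_ C -> ~ C q ->
  exists2 r : R, 0 < r & \forall n \near \oo, forall u, C_ n u -> r <= `|q - u|.
Proof.
move=> CC nCq; apply: contrapT => h; apply: nCq.
have step k m : exists2 n, (m < n)%N & exists2 u, C_ n u & `|q - u| < k.+1%:R^-1.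
  apply: contrapT => nk; apply: h; exists k.+1%:R^-1; first by rewrite invr_gt0.
  exists m.+1 => // n /= mn u Cu; rewrite leNgt; apply/negP => qu.
  by apply: nk; exists n => //; exists u.
have [f hf] := increasing_choice step.
have /choice[x_ hx] : forall k, exists u, C_ (f k.+1) u /\ `|q - u| < k.+1%:R^-1.
  by move=> k; have [_ [u ? ?]] := hf k; exists u.
apply: (CC.2 (fun k => f k.+1) x_) => [k|k|]; first exact: (hf _).1.
  by have [] := hx k.
by apply: cvg_invr_lt => k; have [] := hx k.
Qed.

Variable D : set V.
Hypothesis hD : bounded_convex_domain D.
Local Notation K := (polar D).

(** The map taking [u] to [w + e (w - u)] carries the part of [K] near [q] to a compact convex set
    disjoint from [K]. An [ell z] positive on [K] and negative on the image satisfies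
    [(1 + e) * ell z w < e * ell z u]. *)
Lemma ell_separates_face w q (r e : R) : K w -> K q -> 0 < r -> 0 < e ->
  (forall u, K u -> `|q - u| <= r -> ~ K (w + e *: (w - u))) ->
  exists2 z, D z & forall u, K u -> `|q - u| <= r -> ell z w <= e * ell z u.
Proof.
move=> Kw Kq r0 e0 h.
pose f u : V * R := (w + e *: (w - u), 0).
pose B := K `&` [set u | `|q - u| <= r].
have clB : closed [set u : V | `|q - u| <= r].
  apply: (closed_comp (f := fun u => `|q - u|) (D := [set s | s <= r])); last exact: closed_le.
  move=> u _; apply: (@cvg_norm _ _ _ (nbhs u)); apply: (@cvgB _ _ _ (nbhs u)); first exact: cvg_cst.
  exact: cvg_id.
have cB : compact B.
  apply: (subclosed_compact _ (polar_compact hD)); last by move=> u [].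
  by apply: closedI => //; exact: polar_closed.
have Bs : stable_comb B.
  move=> u v t [Ku qu] [Kv qv] t0 t1; split=> /=; first exact: polar_convex.
  have -> : q - ((1 - t) *: u + t *: v) = (1 - t) *: (q - u) + t *: (q - v).
    by apply/rowP => i; rewrite !mxE; ring.
  apply: le_trans (ler_normD _ _) _.
  rewrite !normrZ (ger0_norm t0) ger0_norm ?subr_ge0 //; move: qu qv => /=; nra.
have [|||||||v [be [k [hA hC]]]] := @closed_convex_sep R N [set r | K r.1] (f @` B).
- apply: (closed_comp (f := fst)); last exact: polar_closed.
  by move=> s _; exact: cvg_fst.
- by exists (w, 0).
- by move=> s s' t Ks Ks' t0 t1; exact: polar_convex.
- apply: continuous_compact cB; apply: continuous_subspaceT => u.
  have h1 : w + e *: (w - v) @[v --> u] --> w + e *: (w - u).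
    apply: (@cvgD _ _ _ (nbhs u)); first exact: cvg_cst.
    apply: cvgZ; first exact: cvg_cst.
    by apply: (@cvgB _ _ _ (nbhs u)); [exact: cvg_cst|exact: cvg_id].
  exact: cvg_pair h1 (cvg_cst _).
- by exists (f q), q => //; split=> //=; rewrite subrr normr0 ltW.
- move=> _ _ t [u Bu <-] [u' Bu' <-] t0 t1; exists ((1 - t) *: u + t *: u'); first exact: Bs.
  congr pair; last by rewrite /= /GRing.scale /= !mulr0 addr0.
  by apply/rowP => i; rewrite !mxE; ring.
- by rewrite -subset0 => s [/= Ks [u [Ku qu] sE]]; apply: (h u) => //; rewrite -sE in Ks.
have hp u : K u -> 0 < - k + dotp v u.
  by move=> Ku; have := hA (u, 0) Ku; rewrite /= mulr0 addr0; lra.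
have [c [z [c0 Dz cz]]] := affine_ell hD hp.
exists z => // u Ku qu; rewrite -(ler_pM2l c0) -cz mulrCA -cz.
have lt : dotp v (f u).1 + be * (f u).2 < k by apply: hC; exists u.
have := mulr_gt0 e0 (hp w Kw); move: lt; rewrite /= !dotpE; lra.
Qed.

(** The function is [1 + ell z / ell z w], with [z] from the preceding lemma. *)
Lemma peaked_functional w q (r e : R) : K w -> K q -> 0 < r -> 0 < e ->
  (forall u, K u -> `|q - u| <= r -> ~ K (w + e *: (w - u))) ->
  exists (c : R) z, [/\ 0 < c, D z, forall u, K u -> 1 <= c * ell z u,
    c * ell z w = 2 & forall u, K u -> `|q - u| <= r -> e^-1 <= c * ell z u].
Proof.
move=> Kw Kq r0 e0 h; have [z Dz hz] := ell_separates_face Kw Kq r0 e0 h.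
have lw := ell_gt0 hD Dz Kw.
have aE u : (1 + (ell z w)^-1) + dotp (- (ell z w)^-1 *: z) u = 1 + ell z u / ell z w.
  by rewrite dotpE (dotpC z) {3}/ell; ring.
have hp u : K u -> 0 < (1 + (ell z w)^-1) + dotp (- (ell z w)^-1 *: z) u.
  by move=> Ku; rewrite aE addr_gt0 // divr_gt0 // (ell_gt0 hD).
have [c [x [c0 Dx cx]]] := affine_ell hD hp.
exists c, x; split=> // [u Ku||u Ku qu]; rewrite -cx aE.
- by rewrite lerDl ltW // divr_gt0 // (ell_gt0 hD).
- by rewrite divff ?gt_eqF //; ring.
apply: ler_wpDl => //; rewrite ler_pdivlMr // ler_pdivrMl //; exact: hz.
Qed.

End NotClosed.

(** * Subsequences extracted from an ultrafilter *)

Section Subsequence.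
Variables (R : realType) (N : nat).
Local Notation V := 'rV[R]_N.
Implicit Types (p q u v w y : V).
Variables (D : set V) (b : V) (x : nat -> V) (U : set_system nat).
Hypotheses (hD : bounded_convex_domain D) (Db : D b) (Dx : forall n, D (x n)).
Context {UU : UltraFilter U}.
Hypothesis oU : \oo `<=` U.

Lemma hilbert_dist_limit : exists g : V -> R, forall y, D y ->
  (fun n => hilbert_dist D y (x n) - hilbert_dist D b (x n)) @ U --> g y.
Proof.
suff /choice[g hg] : forall y, exists l : R, D y ->
    (fun n => hilbert_dist D y (x n) - hilbert_dist D b (x n)) @ U --> l by exists g.
move=> y; have [Dy|nDy] := pselect (D y); last by exists 0.
have [l _ hl] : exists2 l, `[- hilbert_dist D y b, hilbert_dist D y b]%classic l &
    (fun n => hilbert_dist D y (x n) - hilbert_dist D b (x n)) @ U --> l.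
  apply: ultra_compact_cvg; first exact: segment_compact.
  apply: nearW => n; have := hilbert_dist_lip hD Dy Db (Dx n).
  by rewrite /= in_itv /= ler_norml.
by exists l.
Qed.

(** At stage [j] the limit is approximated within [1 / (j + 1)] at the first [j + 1] rational
    points; the uniform Lipschitz bound for the Hilbert distance extends convergence to all of
    [D]. *)
Lemma converging_subsequence (g : V -> R) : (forall y, D y ->
    (fun n => hilbert_dist D y (x n) - hilbert_dist D b (x n)) @ U --> g y) ->
  exists f : nat -> nat, seq_converges_to D b (x \o f) g.
Proof.
move=> xg.
pose F (n : nat) y := hilbert_dist D y (x n) - hilbert_dist D b (x n).
pose rat_point (i : nat) : V := if unpickle i is Some q then map_mx ratr (q : 'rV[rat]_N) else b.
pose good (j : nat) : set nat := [set n | forall i : 'I_j.+1, D (rat_point i) ->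
  `|g (rat_point i) - F n (rat_point i)| < j.+1%:R^-1].
have Ugood j : U (good j).
  apply: filter_forall => i; have [Di|nDi] := pselect (D (rat_point i)); last first.
    by apply: filterS filterT => n _ /nDi.
  have j0 : 0 < j.+1%:R^-1 :> R by rewrite invr_gt0.
  by have /cvgrPdist_lt/(_ _ j0) := xg _ Di; apply: filterS.
have [f [finc hf]] := ultra_subseq _ oU Ugood.
have Flip n y y' : D y -> D y' -> `|F n y - F n y'| <= hilbert_dist D y y'.
  move=> Dy Dy'; rewrite /F opprB addrA subrK; exact: hilbert_dist_lip.
have glip y y' : D y -> D y' -> `|g y - g y'| <= hilbert_dist D y y'.
  move=> Dy Dy'; apply: cvgr_to_le (cvg_norm (cvgB (xg _ Dy) (xg _ Dy'))) _.
  by apply: nearW => n; exact: Flip.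
exists f => y Dy; apply/cvgrPdist_lt => e e0.
have e3 : 0 < e / 3 by rewrite divr_gt0.
have [r r0 hr] := hilbert_dist_near hD Dy e3.
have [q /hr[Dq dq]] := rat_row_dense y r0.
have [k hk] := ex_invr_lt e3.
exists (maxn (pickle q) k) => // n /=; rewrite geq_max => /andP[qn kn].
have ltq : (pickle q < n.+1)%N by rewrite ltnS.
have := hf n (Ordinal ltq); rewrite /rat_point /= pickleK => /(_ Dq) h1.
have h2 : n.+1%:R^-1 <= k.+1%:R^-1 :> R by rewrite lef_pV2 ?posrE // ler_nat ltnS.
have {h2} h1 := lt_trans (lt_le_trans h1 h2) hk.
have h3 := Flip (f n) _ _ Dq Dy; have h4 := glip _ _ Dy Dq.
rewrite (hilbert_dist_sym hD Dq Dy) in h3.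
have {}h3 := le_lt_trans h3 dq; have {}h4 := le_lt_trans h4 dq.
rewrite -/(F (f n) y); move: h1 h3 h4; move: (F _ _) (F _ _) (g _) (g _) => a1 a2 a3 a4.
rewrite !ltr_norml => /andP[? ?] /andP[? ?] /andP[? ?]; apply/andP; split; lra.
Qed.

End Subsequence.

(** * The two implications *)

Section Equivalence.
Variables (R : realType) (N : nat).
Local Notation V := 'rV[R]_N.
Variables (D : set V) (b : V).
Hypotheses (hD : bounded_convex_domain D) (Db : D b).

Lemma cvg_bounded_ultra (U : set_system nat) (UU : UltraFilter U) (x : nat -> V) :
  (forall n, D (x n)) -> exists p : V, x @ U --> p.
Proof.
move=> Dx; have /bounded_normP[B hB] := domain_bounded hD.
have cB : compact [set v : V | `|v| <= B].
  apply: bounded_closed_compact; first by apply/bounded_normP; exists B.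
  exact: closed_norm_le.
have [p _ xp] := ultra_compact_cvg UU cB (nearW _ (fun n => hB _ (Dx n))).
by exists p.
Qed.

Lemma busemann_of_PK_closed (g : V -> R) : PK_closed_family (extreme_set (polar D)) ->
  horofunction D b g -> busemann_point D b g.
Proof.
move=> PK hg; split=> //; have [[x [Dx xg]] ng] := hg.
have sK := stable_of_PK_closed (polar_compact hD) (@polar_convex _ _ D) PK.
have [U [UU oU]] := ultra_nat.
have [p xp] := cvg_bounded_ultra UU Dx.
have {}xg y : D y -> (fun n => hilbert_dist D y (x n) - hilbert_dist D b (x n)) @ U --> g y.
  by move=> Dy B /(xg y Dy) /oU.
(* A limit [p] inside [D] would make [g] the normalized distance to [p], which a horofunction is
   not. *)
have nDp : ~ D p.
  move=> Dp; apply: ng; exists p; split=> // y Dy.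
  have lim : (fun n => hilbert_dist D y (x n) - hilbert_dist D b (x n)) @ U -->
      hilbert_dist D y p - hilbert_dist D b p.
    have h w : D w -> (fun n => hilbert_dist D w (x n)) @ U --> hilbert_dist D w p.
      move=> Dw; apply/cvgrPdist_lt => e e0.
      have [r r0 hr] := hilbert_dist_near hD Dp e0.
      have /cvgrPdist_lt/(_ _ r0) := xp; apply: filterS => n /hr[_ h].
      apply: le_lt_trans h; rewrite (hilbert_dist_sym hD Dw Dp) (hilbert_dist_sym hD Dw (Dx n)).
      exact: hilbert_dist_lip.
    by apply: cvgB; exact: h.
  exact: norm_cvg_unique (xg y Dy) lim.
have [z [Dz zg small]] := stable_busemann_seq hD Db Dx xp xg sK nDp.
have [f [finc hf]] := almost_geodesic_subseq (@hilbert_dist_triangle _ _ _ hD) Dz zg small.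
exists (z \o f); split.
  by split=> [n|]; [exact: Dz|exists 1; split=> // l _; exact: hf].
move=> y Dy; have := zg y Dy => /cvgrPdist_lt h; apply/cvgrPdist_lt => e e0.
have [n0 _ hn] := h e e0; exists n0; first by [].
move=> n nn; apply: (hn (f n)); apply: leq_trans nn _; exact: leq_increasing.
Qed.

Lemma PK_closed_of_busemann :
  (forall g : V -> R, horofunction D b g -> busemann_point D b g) ->
  PK_closed_family (extreme_set (polar D)).
Proof.
move=> HB C_ C clC_ exC_ clC CC; apply: contrapT => nE.
have [p' [q [t [Kp Kq /andP[t0 t1] Cm nCq]]]] :=
  PK_extreme_fails (@polar_closed _ _ D) exC_ CC nE.
set m := _ + _ in Cm.
have [r r0 hr] := PK_avoid CC nCq.
have [m_ [Cm_ m_m]] := CC.1 m Cm.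
have r2 : 0 < r / 2 by rewrite divr_gt0.
(* Extremeness of [C_ n] keeps [m_ n + e (m_ n - u)] out of [K] for [u] near [q], since otherwise
   [u] would belong to [C_ n]. Hence [peaked_functional] applies with [e = 1 / (n + 1)]. *)
have /choice[cx hcx] : forall n, exists cz : R * V, C_ n (m_ n) ->
    (forall u, C_ n u -> r <= `|q - u|) ->
    [/\ 0 < cz.1, D cz.2, forall u, polar D u -> 1 <= cz.1 * ell cz.2 u,
      cz.1 * ell cz.2 (m_ n) = 2 &
      forall u, polar D u -> `|q - u| <= r / 2 -> n.+1%:R <= cz.1 * ell cz.2 u].
  move=> n; have [Cn|nCn] := pselect (C_ n (m_ n)); last by exists (0, 0).
  have [hn|nhn] := pselect (forall u, C_ n u -> r <= `|q - u|); last by exists (0, 0).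
  have Kn : polar D (m_ n) by exact: (exC_ n).1.
  have e0 : 0 < n.+1%:R^-1 :> R by rewrite invr_gt0.
  have [|c [z [c0 Dz h1 h2 h3]]] := peaked_functional hD Kn Kq r2 e0.
    move=> u Ku qu Kv.
    suff : C_ n u by move=> /hn; lra.
    pose e : R := n.+1%:R^-1; have e1 : 0 < 1 + e by rewrite addr_gt0.
    have mE : m_ n = (1 - e / (1 + e)) *: (m_ n + e *: (m_ n - u)) + (e / (1 + e)) *: u.
      by apply/rowP => i; rewrite !mxE; field; rewrite gt_eqF.
    have [_ [_ exn]] := exC_ n.
    have [] // := exn _ u (e / (1 + e)) Kv Ku.
    - exact: divr_gt0.
    - by rewrite ltr_pdivrMr // mul1r ltrDr.
    - by rewrite -mE.
  by exists (c, z) => _ _; split=> // u Ku qu; have := h3 u Ku qu; rewrite invrK.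
(* Indices are shifted by [n0] so that the properties hold for every [n]. *)
have [n0 _ hn0] := filterI Cm_ hr.
pose x n := (cx (n + n0)%N).2; pose c n := (cx (n + n0)%N).1; pose w n := m_ (n + n0)%N.
have hx n : [/\ 0 < c n, D (x n), forall u, polar D u -> 1 <= c n * ell (x n) u,
    c n * ell (x n) (w n) = 2 &
    forall u, polar D u -> `|q - u| <= r / 2 -> n.+1%:R <= c n * ell (x n) u].
  have [/= C1 C2] := hn0 (n + n0)%N (leq_addl _ _).
  have [c0 Dz h1 h2 h3] := hcx _ C1 C2; split=> // u Ku qu.
  by apply: le_trans (h3 u Ku qu); rewrite ler_nat ltnS leq_addr.
have Kw n : polar D (w n).
  by have [/= C1 C2] := hn0 (n + n0)%N (leq_addl _ _); exact: ((exC_ (n + n0)%N).1 _ C1).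
have wm : w @ \oo --> m.
  apply/cvgrPdist_lt => e e0; have /cvgrPdist_lt/(_ _ e0)[n1 _ h1] := m_m.
  by exists n1 => // k /= kn; apply: h1 => /=; exact: leq_trans kn (leq_addr _ _).
have Dx n : D (x n) by have [] := hx n.
have [d d0 hd] := ell_ge_domain hD Db.
have [B B0 hB] : exists2 B : R, 0 < B & forall u, polar D u -> ell b u <= B.
  have [k k0 hk] := ell_lip hD; exists (1 + k * `|b|).
    by rewrite ltr_wpDr // mulr_ge0 // ltW.
  move=> u Ku; have := hk u b 0 Ku; rewrite subr0 {2}/ell dotpE subr0.
  by rewrite ler_norml => /andP[_]; lra.
have Mle n : funk D b (x n) <= B * c n.
  apply: (funk_le hD) => // u Ku; have [c0 _ h1 _ _] := hx n.
  rewrite -mulrA; apply: le_trans (hB u Ku) _.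
  by apply: ler_peMr; [exact: ltW|exact: h1].
have Mge n : d / 2 * c n <= funk D b (x n).
  have [c0 _ _ h2 _] := hx n; have := funk_ell hD b (Dx n) (Kw n); have := hd _ (Kw n).
  have := funk_gt0 hD b (Dx n).
  move: (funk D b (x n)) (ell (x n) (w n)) (ell b (w n)) h2 => M l lb h2 M0 dl Ml.
  have : d * c n <= M * l * c n by rewrite ler_pM2r //; lra.
  have -> : M * l * c n = M * (c n * l) by ring.
  rewrite h2; lra.
have [U [UU oU]] := ultra_nat.
have [p xp] := cvg_bounded_ultra UU Dx.
have [g xg] := hilbert_dist_limit hD Db Dx (UU := UU).
have [f fg] := converging_subsequence hD Dx oU xg.
have Am : epilimit D b x U (m, B * 2).
  split; first by apply: polar_convex => //; exact: ltW.
  move=> e e0; have /cvgrPdist_lt/(_ _ e0) h1 := wm; apply: filterS (oU _ h1) => n mw.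
  exists (w n) => //; split=> //=; apply: (@le_lt_trans _ _ (B * 2)); last by rewrite ltrDl.
  have [c0 _ _ h2 _] := hx n; rewrite /scaled_ell -h2 mulrA ler_pM2r ?Mle //.
  exact: (ell_gt0 hD).
have nAq s : ~ epilimit D b x U (q, s).
  move=> [_ h]; pose k := Num.truncn ((s + r / 2) / (d / 2)).
  have k1 : \forall n \near U, (k <= n)%N by apply: oU; exact: nbhs_infty_ge.
  have [n [/= kn [u Ku [qu]]]] := filter_ex (filterI k1 (h _ r2)).
  rewrite ltNge => /negP; apply.
  have [c0 _ _ _ h3] := hx n.
  have sk : (s + r / 2) <= d / 2 * n.+1%:R.
    rewrite [leRHS]mulrC -ler_pdivrMr ?divr_gt0 //; apply/ltW/(lt_le_trans (truncnS_gt _)).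
    by rewrite ler_nat ltnS.
  apply: le_trans sk _; apply: le_trans (_ : d / 2 * (c n * ell (x n) u) <= _).
    by rewrite ler_pM2l ?divr_gt0 // h3 // ltW.
  by rewrite mulrA ler_pM2r ?Mge // (ell_gt0 hD).
have core z : (forall n, D (z n)) -> seq_converges_to D b z g ->
    (forall e : R, 0 < e -> \forall n \near \oo, hilbert_dist D b (z n) + g (z n) <= e) -> False.
  move=> Dz zg small.
  have [s' As'] := busemann_domain_extreme hD Db Dx xp xg oU Dz zg small Kp Kq t0 t1 Am.
  exact: nAq As'.
(* If [g] were the normalized distance to some [y] in [D], the constant sequence at [y] would have
   zero defect and [core] would apply to it. *)
have hg : horofunction D b g.
  split; first by exists (x \o f); split=> // n; exact: Dx.
  move=> [y [Dy gy]]; apply: (core (fun=> y)); [by move=> _|move=> v Dv|move=> e e0].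
    by rewrite gy //; exact: cvg_cst.
  by apply: nearW => n; rewrite gy // hilbert_distxx sub0r subrr ltW.
have [_ [z [[Dz [eps [eps0 ag]]] zg]]] := HB g hg.
apply: (core z Dz zg).
exact: (almost_geodesic_limit (P := D) (d := hilbert_dist D) (@hilbert_distxx _ _ D)
  (@hilbert_dist_triangle _ _ _ hD) Dz zg ag).
Qed.

End Equivalence.

Theorem theorem1p2 (R : realType) (N : nat) (D : set 'rV[R]_N) (b : 'rV[R]_N) :
  bounded_set D -> convex D -> open D -> D 0 -> D b ->
  ((forall g : 'rV[R]_N -> R, horofunction D b g -> busemann_point D b g) <->
   PK_closed_family (extreme_set (polar D))).
Proof.
move=> bD cD oD D0 Db; have hD := BoundedConvexDomain bD cD oD D0.
split=> [|PK g]; first exact: PK_closed_of_busemann.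
exact: busemann_of_PK_closed.
Qed.
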